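(* Let $W\in gr^{(2)}$ (equivalently $W=g(t)H_n^{(0)}$ with $g\in GL_n(L)^{(2)}$) and let $\sigma(|W\rangle)=\sum_{\alpha\in M}\tau_\alpha(x)e^\alpha$ be its tau-function. For $i\neq j$ define \[ \gamma_{ij}(x)=\varepsilon_{ji}\left(\frac{\tau_{\delta_i-\delta_j}(x)}{\tau_0(x)}\right)\Big|_{x^{(\ell)}_{2k}=0\ \text{for all }k\ge1,\,1\le\ell\le n}. \] Then, with $u_i=x^{(i)}_1$ and $\partial_i=\partial/\partial u_i$ (the variables $x^{(\ell)}_{2k+1}$, $k\ge1$, being parameters), the $\gamma_{ij}$ satisfy the Darboux–Egoroff system: for pairwise distinct $i,j,k$, \[ \gamma_{ij}=\gamma_{ji},\qquad \partial_k\gamma_{ij}=\gamma_{ik}\gamma_{kj},\qquad \sum_{k=1}^n\partial_k\gamma_{ij}=0. \]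
   Context: Standing setup. Fix $n\ge2$, let $e_1,\dots,e_n$ be the standard basis of $\mathbb{C}^n$ and $H_n=\mathbb{C}^n((t))$ (formal Laurent series with finitely many negative powers). For $1\le j\le n$, $k\in\mathbb{Z}$ put $v_{-n(k+1)+j-\frac12}=v^{(j)}_{-k-\frac12}:=e_jt^k$. Let $H_n^{(j)}$ be the space of sums $\sum_{m<j}b_mv_m$ (so $H_n^{(0)}=\mathbb{C}^n[[t]]$); $Gr_0$ is the set of subspaces $W\subset H_n$ with $H_n^{(j)}\subset W$ and $\dim W/H_n^{(j)}=-j$ for all $j\ll0$; $gr_0=\{W\in Gr_0:tW\subset W\}$; $\langle u,v\rangle=i\,\mathrm{Res}_t\sum_a u_a(t)v_a(-t)$; $gr^{(2)}=\{W\in gr_0:\langle W,W\rangle=0\}$; $L=\mathbb{C}[t,t^{-1}]$ and $GL_n(L)^{(2)}=\{A(t)\in GL_n(L):A(-t)=(A(t)^T)^{-1}\}$. Fock space: $F^{(0)}$ is the span of semi-infinite wedges $u_{-\frac12}\wedge u_{-\frac32}\wedge\cdots$ ($u_m\in H_n$, $u_m=v_m$ for $m\ll0$), multilinear and alternating, with vacuum $|0\rangle=v_{-\frac12}\wedge v_{-\frac32}\wedge\cdots$; $F=\oplus_cF^{(c)}$ is defined similarly with tails $v_{c-\frac12-k}$. For $W\in Gr_0$ choose $N$ with $H_n^{(-N)}\subset W$, $\dim W/H_n^{(-N)}=N$, and a basis $w_{-\frac12},\dots,w_{-N+\frac12}$ of $W$ mod $H_n^{(-N)}$; set $|W\rangle=w_{-\frac12}\wedge\cdots\wedge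 w_{-N+\frac12}\wedge v_{-N-\frac12}\wedge v_{-N-\frac32}\wedge\cdots$ (defined up to a nonzero scalar). For $w\in H_n$, $\psi(w)$ is left wedging with $w$; for a continuous linear functional $f$, $\psi(f)(u_1\wedge u_2\wedge\cdots)=\sum_{k\ge1}(-1)^{k-1}f(u_k)\,u_1\wedge\cdots\wedge\widehat{u_k}\wedge\cdots$. Let $v^{(j)*}_r$ be the functional with $v^{(j)*}_r(v^{(i)}_s)=\delta_{ij}\delta_{r,-s}$. Put $\psi^{+(j)}_k=\psi(v^{(j)}_{-k})$, $\psi^{-(j)}_k=\psi(v^{(j)*}_{-k})$ ($k\in\frac12+\mathbb{Z}$), and $\alpha^{(j)}_k=\sum_{\ell}\psi^{+(j)}_\ell\psi^{-(j)}_{k-\ell}$ for $k\ne0$, $\alpha^{(j)}_0=\sum_{\ell>0}\psi^{+(j)}_{-\ell}\psi^{-(j)}_{\ell}-\sum_{\ell>0}\psi^{-(j)}_{-\ell}\psi^{+(j)}_{\ell}$. Let $Q_i$ ($1\le i\le n$) be the operators on $F$ determined by $Q_i|0\rangle=\psi^{+(i)}_{-\frac12}|0\rangle$ and $Q_i\psi^{\pm(j)}_k=(-1)^{\delta_{ij}+1}\psi^{\pm(j)}_{k\mp\delta_{ij}}Q_i$. Let $N=\oplus_i\mathbb{Z}\delta_i$ with $(\delta_i|\delta_j)=\delta_{ij}$, $M=\{\gamma\in N:(\delta_1+\dots+\delta_n|\gamma)=0\}$, $\varepsilon_{ij}=-1$ if $i>j$ and $1$ if $i\le j$, $\varepsilon$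 the bimultiplicative function with $\varepsilon(\delta_i,\delta_j)=\varepsilon_{ij}$, and $\mathbb{C}[M]$ the twisted group algebra with basis $e^\gamma$, $e^\alpha e^\beta=\varepsilon(\alpha,\beta)e^{\alpha+\beta}$. Let $x=\{x^{(i)}_k\}_{k\ge1,1\le i\le n}$. The boson–fermion correspondence is the linear isomorphism $\sigma:F^{(0)}\to\mathbb{C}[x]\otimes\mathbb{C}[M]$, $\sigma(\alpha^{(i_1)}_{-m_1}\cdots\alpha^{(i_s)}_{-m_s}Q_1^{k_1}\cdots Q_n^{k_n}|0\rangle)=m_1\cdots m_s\,x^{(i_1)}_{m_1}\cdots x^{(i_s)}_{m_s}\otimes e^{k_1\delta_1+\dots+k_n\delta_n}$ ($m_r>0$, $\sum k_i=0$). The tau-function of $W\in Gr_0$ is $\sigma(|W\rangle)=\sum_{\alpha\in M}\tau_\alpha(x)e^\alpha$, $\tau_\alpha\in\mathbb{C}[x]$. All ratios are taken where $\tau_0\neq0$. *)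

(* Defs.v *)
From HB Require Import structures.
From mathcomp Require Import all_boot all_order all_algebra.
From mathcomp Require Import complex.
From mathcomp Require Import reals.
From Stdlib Require Import ClassicalEpsilon.

Set Implicit Arguments.
Unset Strict Implicit.
Unset Printing Implicit Defensive.

Import Order.TTheory GRing.Theory Num.Theory.
Local Open Scope ring_scope.

Section BosonFermion.

Variables (R : realType) (n : nat).
Local Notation C := (R[i]).

(* The space H_n = C^n((t)).  An element is its array of Laurent       *)
(* coefficients: u a k = coefficient of e_(a+1) t^k  (a : 'I_n, k : int) *)
Definition Hvec := 'I_n -> int -> C.

Definition lbound (K : nat) (u : Hvec) : Prop :=
  forall a (k : int), k < - (K%:Z) -> u a k = 0.
Definition laurent (u : Hvec) : Prop := exists K, lbound K u.

(* Index conventions.  We write the half-integer index m of v_m as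
   m = P - 1/2 with P : int.  Then v_{P-1/2} = e_(a+1) t^k  where
   P = -n(k+1) + (a+1)   (a : 'I_n the colour, k the power of t).      *)
Definition pos (a : 'I_n) (k : int) : int := - (n%:Z * (k + 1)) + a%:Z + 1.
Definition colz (P : int) : int := ((P - 1) %% n%:Z)%Z.     (* = a *)
Definition tpow (P : int) : int := - ((P - 1) %/ n%:Z)%Z - 1. (* = k *)

Definition vcoord (u : Hvec) (P : int) : C :=
  \sum_(a < n) (if a%:Z == colz P then u a (tpow P) else 0).

(* H_n^{(j)}: sums  sum_{m < j} b_m v_m , i.e. vanishing coords for P > j *)
Definition Hj (j : int) (u : Hvec) : Prop :=
  forall P : int, j < P -> vcoord u P = 0.

Definition lin_comb d (c : 'I_d -> C) (w : 'I_d -> Hvec) : Hvec :=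
  fun a k => \sum_(i < d) c i * w i a k.

Definition subspace (W : Hvec -> Prop) : Prop :=
  W (fun _ _ => 0) /\
  forall (c : C) u v, W u -> W v -> W (fun a k => c * u a k + v a k).

Definition basis_mod (W : Hvec -> Prop) (j : int) d (w : 'I_d -> Hvec) : Prop :=
  [/\ forall i, W (w i),
      forall c : 'I_d -> C, Hj j (lin_comb c w) -> forall i, c i = 0 &
      forall u, W u -> exists c : 'I_d -> C,
         Hj j (fun a k => u a k - lin_comb c w a k)].

Definition in_Gr0 (W : Hvec -> Prop) : Prop :=
  exists N0 : nat, forall N : nat, (N0 <= N)%N ->
    (forall u, Hj (- N%:Z) u -> W u) /\
    exists w : 'I_N -> Hvec, basis_mod W (- N%:Z) w.

Definition tmul (u : Hvec) : Hvec := fun a k => u a (k - 1).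

Definition in_gr0 (W : Hvec -> Prop) : Prop :=
  in_Gr0 W /\ forall u, W u -> W (tmul u).

(* <u,v> = i Res_t sum_a u_a(t) v_a(-t); when u, v have no powers below
   t^{-K} every nonzero term of the residue has  -K <= k <= K-1.        *)
Definition pairing (K : nat) (u v : Hvec) : C :=
  'i * \sum_(a < n) \sum_(l < 2 * K)
     (let k : int := l%:Z - K%:Z in
      u a k * v a (- 1 - k) * (-1) ^ (- 1 - k)).

Definition isotropic (W : Hvec -> Prop) : Prop :=
  forall (K : nat) u v, W u -> W v -> lbound K u -> lbound K v ->
    pairing K u v = 0.

Definition in_gr2 (W : Hvec -> Prop) : Prop := in_gr0 W /\ isotropic W.

(* Fock space.  A basis semi-infinite wedge of charge c is              *)
(*   v_{s_0 - 1/2} /\ v_{s_1 - 1/2} /\ ...,   s_l = c - l + lambda_l,    *)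
(* with lambda a partition (s strictly decreasing, s_l = c - l for l>>0) *)
(* Vectors of F are coefficient functions on these basis wedges.       *)
Definition part := {s : seq nat | sorted geq s && all (fun x => (0 < x)%N) s}.
Definition part0 : part := exist _ [::] isT.
Definition maya := (int * part)%type.

Definition sq (d : maya) (l : nat) : int := d.1 - l%:Z + (nth 0%N (val d.2) l)%:Z.

Definition mk_maya (c : int) (s : nat -> int) (K : nat) : maya :=
  (c, insubd part0 [seq x <- [seq absz (s l - c + l%:Z) | l <- iota 0 K] | (0 < x)%N]).

Definition mbound (d : maya) (P : int) : nat := (absz (sq d 0 - P)).+1.

Definition inm (d : maya) (P : int) : bool :=
  [exists l : 'I_(mbound d P), sq d l == P].

Definition above (d : maya) (P : int) : nat :=
  (\sum_(l < mbound d P) nat_of_bool (P < sq d l)%R)%N.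

(* remove P (assumed present): charge drops by one *)
Definition mdel (d : maya) (P : int) : maya :=
  mk_maya (d.1 - 1)
    (fun l => if P < sq d l then sq d l else sq d l.+1)
    (size (val d.2) + mbound d P).

(* insert P (assumed absent): charge rises by one *)
Definition mins (d : maya) (P : int) : maya :=
  mk_maya (d.1 + 1)
    (fun l => if P < sq d l then sq d l
              else if (l == 0)%N || (P < sq d l.-1) then P else sq d l.-1)
    (size (val d.2)).+2.

Definition Fock := maya -> C.

Definition vac : Fock := fun d => if d == (0%Z, part0) then 1 else 0.

(* psi(v_{P-1/2}) : left wedging with v_{P-1/2} *)
Definition wedge (P : int) (f : Fock) : Fock :=
  fun d => if inm d P then (-1) ^+ above d P * f (mdel d P) else 0.

(* psi(v_{P-1/2}^* ) : contraction with the functional dual to v_{P-1/2} *)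
Definition contr (P : int) (f : Fock) : Fock :=
  fun d => if inm d P then 0 else (-1) ^+ above d P * f (mins d P).

(* psi^{+(j)}_k = psi(e_j t^{k-1/2}),  psi^{-(j)}_k = psi( dual of e_j t^{-k-1/2} ).
   We index by the power of t:  psip j a := psi^{+(j)}_{a+1/2},
   psim j a := psi^{-(j)}_{-a-1/2}. *)
Definition psip (j : 'I_n) (a : int) : Fock -> Fock := wedge (pos j a).
Definition psim (j : 'I_n) (a : int) : Fock -> Fock := contr (pos j a).

(* alpha^{(j)}_{-m}, m >= 1:  sum_a psip j a \o psim j (a+m), i.e. the sum
   over the colour-j occupied positions P of the output wedge of
   wedge P \o contr (P - n m).  Terms with l >= size lambda + n m vanish. *)
Definition alpha (j : 'I_n) (m : nat) (f : Fock) : Fock :=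
  fun d => \sum_(l < size (val d.2) + n * m + 1)
    (let P := sq d l in
     if colz P == j%:Z then
       (let d' := mdel d P in let P2 := P - (n * m)%:Z in
        if inm d' P2 then 0
        else (-1) ^+ (above d P + above d' P2) * f (mins d' P2))
     else 0).

Definition Q_spec (Q Qi : 'I_n -> Fock -> Fock) : Prop :=
  [/\ forall i, cancel (Q i) (Qi i) /\ cancel (Qi i) (Q i),
      forall i (c : C) f g, Q i (fun d => c * f d + g d) = (fun d => c * Q i f d + Q i g d),
      forall i, Q i vac = psip i (-1) vac,
      forall i j a f, Q i (psip j a f) =
          (fun d => (if i == j then 1 else -1) * psip j (a - (i == j)%:Z) (Q i f) d) &
      forall i j a f, Q i (psim j a f) =
          (fun d => (if i == j then 1 else -1) * psim j (a - (i == j)%:Z) (Q i f) d)].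

Definition Qpow (Q Qi : 'I_n -> Fock -> Fock) (i : 'I_n) (k : int) : Fock -> Fock :=
  match k with Posz m => iter m (Q i) | Negz m => iter m.+1 (Qi i) end.

Definition Qword Q Qi (k : 'I_n -> int) (v : Fock) : Fock :=
  foldr (fun i acc => Qpow Q Qi i (k i) acc) v (enum 'I_n).

(* Target  C[x] (x) C[M] :  functions  M -> C[x],  where C[x] is viewed  *)
(* as polynomial functions of  x : 'I_n -> nat -> C,                    *)
(* x i k = x^{(i+1)}_k  (k >= 1; the value at k = 0 is unused).         *)
Definition Mlat := {ffun 'I_n -> int}.
Definition Xvar := 'I_n -> nat -> C.
Definition Target := Mlat -> Xvar -> C.

Definition bf_spec (Q Qi : 'I_n -> Fock -> Fock) (sigma : Fock -> Target) : Prop :=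
  (forall (c : C) f g, sigma (fun d => c * f d + g d) =
      (fun g0 x => c * sigma f g0 x + sigma g g0 x)) /\
  (forall (ws : seq ('I_n * nat)) (k : Mlat),
      all (fun p => (0 < p.2)%N) ws -> \sum_(i < n) k i = 0 ->
      sigma (foldr (fun p v => alpha p.1 p.2 v) (Qword Q Qi k vac) ws) =
      (fun g0 x => if g0 == k then
          (\prod_(p <- ws) (p.2)%:R) * \prod_(p <- ws) x p.1 p.2 else 0)).

(* |W> from a basis w of W modulo H^{(-N)}: the coefficient of the basis
   wedge d in  w_0 /\ ... /\ w_{N-1} /\ v_{-N-1/2} /\ v_{-N-3/2} /\ ...  *)
Definition ketW (N : nat) (w : 'I_N -> Hvec) : Fock :=
  fun d => if (d.1 == 0) && (size (val d.2) <= N)%N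
           then \det (\matrix_(i < N, l < N) vcoord (w i) (sq d l))
           else 0.

Definition delta (i : 'I_n) : Mlat := [ffun l => ((l == i) : int)].
Definition Msub (a b : Mlat) : Mlat := [ffun l => a l - b l].
Definition M0 : Mlat := [ffun _ => 0].

Definition epsM (i j : 'I_n) : C := if (j < i)%N then -1 else 1.

Definition restrict_even (x : Xvar) : Xvar := fun i k => if odd k then x i k else 0.

Definition rat_rep (phi : C -> C) (pq : {poly C} * {poly C}) : Prop :=
  pq.2.[0] != 0 /\ forall h, pq.2.[h] != 0 -> phi h = pq.1.[h] / pq.2.[h].

Definition rderiv0 (phi : C -> C) : C :=
  let pq := epsilon (inhabits (0, 1)) (rat_rep phi) in
  ((pq.1^`()).[0] * pq.2.[0] - pq.1.[0] * (pq.2^`()).[0]) / pq.2.[0] ^+ 2.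

Definition upd (x : Xvar) (k : 'I_n) (h : C) : Xvar :=
  fun i m => if (i == k) && (m == 1)%N then x i m + h else x i m.

Definition pd (k : 'I_n) (g : Xvar -> C) (x : Xvar) : C :=
  rderiv0 (fun h => g (upd x k h)).

End BosonFermion.

(* Main.v *)
(* Let E_x f be the coefficient of e^0 in sigma(f), evaluated at x, and let X be the diagonal
   matrix with entries sum_(m >= 1) x^(a)_m t^m. Since alpha_(-m) acts through sigma as m x_m,
   commuting the alpha's through a fermion shows that E_x (Q_i^-1 psi(e^(-X) e_l t^b) f) is 0
   for b < -1, is [l = i] E_x f for b = -1, and is - E_x (Q_l Q_i^-1 f) for b = 0, l <> i, which
   is tau_(delta_i - delta_l) up to a sign. As psi(u) |W> = 0 for u in W, every u in W gives a
   linear relation between these numbers, whose coefficients are those of e^X u.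
   When tau_0(x) <> 0 the relations, applied to u, t u, t^2 u, ..., show that e^X W meets
   t^-1 C^n[[t^-1]] trivially, so that it contains a unique Psi_j = e_j + t^-1 B_j + ..., and the
   relation for e^(-X) Psi_j says gamma_ij = - B_ij. Then isotropy of e^X W (only odd times are
   left) gives B_ij = B_ji; differentiating the relation for the fixed vector e^(-X) Psi_j along
   x^(k)_1 gives the derivatives of B_ij, and summing over k yields the relation for
   t e^(-X) Psi_j, which vanishes because t W is contained in W.
   The alpha's and Q's generate the charged Fock space, by Newton's identities
   m psi_(-m-1/2) |0> = sum_(r = 1..m) alpha_(-r) psi_(-(m-r)-1/2) |0>, so that E_x is determined
   by its values on the words of the boson-fermion correspondence. *)

Require Import Defs.
From HB Require Import structures.
From mathcomp Require Import all_boot all_order all_algebra.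
From mathcomp Require Import complex.
From mathcomp Require Import reals.
From mathcomp Require Import boolp functions zify ring lra.
Set Implicit Arguments.
Unset Strict Implicit.
Unset Printing Implicit Defensive.
Import Order.TTheory GRing.Theory Num.Theory.
Local Open Scope ring_scope.

(** * Maya diagrams *)

(** The relations used are linear in |W>, in contrast to bilinear Hirota identities; this is what
    allows one fixed vector of W to be differentiated in the times. Three obstacles shape the
    development. [Fock] contains all functions on diagrams, while sigma is specified only by
    linearity and its values on words: identities are confined to the span [FinC] of fermion
    monomials on the vacuum, carried over to words by [FinC_AspC], and |W> has to be placed in
    [FinC]. The exponentials are infinite series: since the poles in W are uniformly bounded,
    everything is shifted by t^K to sequences indexed by nat, and the fermion sums are cut at an M
    independent of the times, so that each relation stays a polynomial identity along a line in time
    space. Finally [rderiv0] picks an arbitrary rational representation, so its value must be shown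
    independent of the choice. The existence of Psi_j follows from the trivial intersection because
    W lies in Gr_0: modulo H^(-N), projecting e^X W to C^n[[t]] is a square linear system of size
    N. *)

Lemma sum_support (V : nmodType) (T : eqType) (r1 r2 : seq T) (F : T -> V) :
  uniq r1 -> uniq r2 ->
  (forall x, F x != 0 -> (x \in r1) = (x \in r2)) ->
  \sum_(x <- r1) F x = \sum_(x <- r2) F x.
Proof.
move=> u1 u2 H.
rewrite (bigID (fun x => F x != 0)) /= [X in _ + X]big1 ?addr0; last first.
  by move=> x; rewrite negbK => /eqP.
rewrite [RHS](bigID (fun x => F x != 0)) /= [X in _ = _ + X]big1 ?addr0; last first.
  by move=> x; rewrite negbK => /eqP.
rewrite -big_filter -[RHS]big_filter; apply: perm_big.
apply: uniq_perm; rewrite ?filter_uniq // => x.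
by rewrite !mem_filter; case E: (F x != 0) => //=; apply: H.
Qed.

Section Maya.
Implicit Types (d : maya) (P Q : int).

Lemma nth_filter_pos (s : seq nat) (l : nat) : sorted geq s ->
  nth 0%N [seq x <- s | (0 < x)%N] l = nth 0%N s l.
Proof.
elim: s l => // -[|x] s IH l /= ps.
  have s0 : all (geq 0%N) s by move: ps; rewrite (path_sortedE (rev_trans leq_trans)) => /andP[].
  have -> : [seq x <- s | (0 < x)%N] = [::].
    apply/eqP; rewrite -[_ == _]negbK -has_filter; apply/hasPn => x xs.
    by move/allP: s0 => /(_ x xs); rewrite /=; lia.
  rewrite nth_nil; case: l => //= l.
  case: (ltnP l (size s)) => [ls|ls]; last by rewrite nth_default.
  by move/allP: s0 => /(_ _ (mem_nth 0%N ls)) /=; lia.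
by case: l => //= l; apply: IH; apply: path_sorted ps.
Qed.

Lemma sq_dec d l : sq d l.+1 < sq d l.
Proof.
rewrite /sq; suff: (nth 0%N (val d.2) l.+1 <= nth 0%N (val d.2) l)%N by lia.
have /andP[srt _] := valP d.2.
case: (ltnP l.+1 (size (val d.2))) => ls; last by rewrite nth_default.
move: srt; case: (val d.2) ls => // x s ls /(pathP 0%N) /(_ l ls).
by [].
Qed.

Lemma dec_lt (s : nat -> int) : (forall l, s l.+1 < s l) ->
  forall i j, (i < j)%N -> s j < s i.
Proof.
move=> H i j; elim: j => // j IH; rewrite ltnS leq_eqVlt => /orP[/eqP->|/IH]; first exact: H.
by move=> h; apply: lt_trans (H j) h.
Qed.

Lemma dec_ltE (s : nat -> int) : (forall l, s l.+1 < s l) ->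
  forall i j, (s j < s i) = (i < j)%N.
Proof.
move=> H i j; case: (ltngtP i j) => [|ji|->]; [exact: dec_lt| | by rewrite ltxx].
by apply/negbTE; rewrite -leNgt ltW // dec_lt.
Qed.

Lemma sq_ltE d i j : (sq d j < sq d i) = (i < j)%N.
Proof. exact: (dec_ltE (s := sq d) (sq_dec d)). Qed.

Lemma sq_inj d : injective (sq d).
Proof.
move=> i j e; case: (ltngtP i j) => //; rewrite -(sq_ltE d) e ltxx //.
Qed.

Lemma sq_large d l : (size (val d.2) <= l)%N -> sq d l = d.1 - l%:Z.
Proof. by move=> h; rewrite /sq nth_default // addr0. Qed.

Lemma sq_le_sub d i l : sq d l <= sq d i -> sq d l <= sq d i - (l%:Z - i%:Z).
Proof.
rewrite leNgt sq_ltE -leqNgt => il.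
elim: l il => [|l IH]; first by rewrite leqn0 => /eqP ->; lia.
rewrite leq_eqVlt => /orP[/eqP ->|il]; first lia.
have := IH il; have := sq_dec d l; lia.
Qed.

(** The sequence drops by at least 1 at each step, so s l + l is nonincreasing with final value c.
    Hence the [absz] in [mk_maya] never changes a sign. *)
Lemma dec_ge_tail (c : int) (s : nat -> int) (K : nat) : (forall l, s l.+1 < s l) ->
  (forall l, (K <= l)%N -> s l = c - l%:Z) -> forall l, 0 <= s l - c + l%:Z.
Proof.
move=> H HK l; have [/HK->|lK] := leqP K l; first by lia.
move: (HK K (leqnn K)).
have -> : K = (l + (K - l))%N by lia.
move: (K - l)%N => m; elim: m {lK HK} c => [|m IH] c; first by rewrite addn0; lia.
rewrite addnS => e; have := H (l + m)%N.
have := IH (s (l + m)%N + (l + m)%N%:Z); rewrite e; lia.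
Qed.

Lemma sq_mk (c : int) (s : nat -> int) (K : nat) : (forall l, s l.+1 < s l) ->
  (forall l, (K <= l)%N -> s l = c - l%:Z) ->
  forall l, sq (mk_maya c s K) l = s l.
Proof.
move=> H HK l; rewrite /sq /mk_maya /=.
have tge := dec_ge_tail H HK.
set t := [seq absz _ | l <- _].
have nt m : nth 0%N t m = absz (s m - c + m%:Z).
  have [mK|mK] := ltnP m K; first by rewrite (nth_map 0%N) ?size_iota // nth_iota.
  by rewrite nth_default ?size_map ?size_iota // HK //; lia.
have st : sorted geq t.
  apply/(sortedP 0%N) => i _; rewrite !nt.
  by have := H i; have := tge i; have := tge i.+1; rewrite /geq /=; lia.
rewrite val_insubd.
have -> : sorted geq [seq x <- t | (0 < x)%N] && all (fun x => (0 < x)%N) [seq x <- t | (0 < x)%N].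
  by rewrite filter_all andbT (sorted_filter (rev_trans leq_trans)).
by rewrite nth_filter_pos // nt; have := tge l; lia.
Qed.

Lemma inmP d P : reflect (exists l, sq d l = P) (inm d P).
Proof.
apply: (iffP idP) => [/existsP[l /eqP <-]|[l e]]; first by exists l.
have lb : (l < mbound d P)%N.
  have := @sq_le_sub d 0 l; rewrite leNgt sq_ltE /mbound -e /=; lia.
by apply/existsP; exists (Ordinal lb); rewrite /= e.
Qed.

Lemma inm_sq d l : inm d (sq d l).
Proof. by apply/inmP; exists l. Qed.

Lemma inm_low d P : P <= d.1 - (size (val d.2))%:Z -> inm d P.
Proof.
move=> h; apply/inmP; exists (absz (d.1 - P)); rewrite sq_large; lia.
Qed.

Lemma dec_range_eq (s s' : nat -> int) :
  (forall l, s l.+1 < s l) -> (forall l, s' l.+1 < s' l) ->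
  (forall l, exists m, s' m = s l) -> (forall l, exists m, s m = s' l) ->
  forall l, s l = s' l.
Proof.
move=> H H' h h'; have D := dec_ltE H; have D' := dec_ltE H'.
(* If the sequences agree below l, then s l is a value of s' at an index at least l, so s l <= s' l,
   and symmetrically. *)
have key : forall l, (forall k, (k < l)%N -> s k = s' k) -> s l = s' l.
  move=> l IH.
  have [m em] := h l; have [m' em'] := h' l.
  have lm : (l <= m)%N.
    rewrite leqNgt; apply/negP => /[dup] ml /IH e; move: em; rewrite -e => e'.
    by have := D m l; rewrite e' ltxx ml.
  have lm' : (l <= m')%N.
    rewrite leqNgt; apply/negP => /[dup] ml /IH e; move: em'; rewrite e => e'.
    by have := D' m' l; rewrite e' ltxx ml.
  have := D l m'; rewrite em'; have := D' l m; rewrite em.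
  move: lm lm'; rewrite leq_eqVlt => /orP[/eqP e|->].
    by move: em; rewrite -e.
  rewrite leq_eqVlt => /orP[/eqP e|->]; first by rewrite -em' -e.
  lia.
move=> l; elim: l {-2}l (leqnn l) => [|l IH] k kl; apply: key => m mk; first lia.
by apply: IH; lia.
Qed.

Lemma maya_sq_ext d d' : (forall l, sq d l = sq d' l) -> d = d'.
Proof.
move=> e.
have e1 : d.1 = d'.1.
  have := e (maxn (size (val d.2)) (size (val d'.2))).
  by rewrite !sq_large ?leq_maxl ?leq_maxr //; lia.
have en l : nth 0%N (val d.2) l = nth 0%N (val d'.2) l.
  by have := e l; rewrite /sq e1; lia.
have le_size : forall p q : part, (forall l, nth 0%N (val p) l = nth 0%N (val q) l) ->
    (size (val p) <= size (val q))%N.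
  move=> p q E; rewrite leqNgt; apply/negP => lt.
  have /andP[_ /allP pos] := valP p.
  have := pos _ (mem_nth 0%N lt); rewrite E nth_default //.
case: d d' e e1 en => [c p] [c' p'] /= _ -> en; congr pair; apply: val_inj.
apply: (@eq_from_nth _ 0%N) => [|i _]; last exact: en.
by apply/eqP; rewrite eqn_leq !le_size.
Qed.

(** Turns every identity between diagrams into Boolean reasoning on occupied positions; the sequence
    encoding is hardly touched afterwards. *)
Lemma maya_ext d d' : inm d =1 inm d' -> d = d'.
Proof.
move=> e; apply: maya_sq_ext; apply: dec_range_eq; try exact: sq_dec.
- by move=> l; apply/inmP; rewrite -e inm_sq.
- by move=> l; apply/inmP; rewrite e inm_sq.
Qed.

Lemma sq_mdel d l0 l :
  sq (mdel d (sq d l0)) l = if (l < l0)%N then sq d l else sq d l.+1.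
Proof.
rewrite sq_mk ?sq_ltE // => {}l.
- rewrite !sq_ltE; case: ltnP => h1; case: ltnP => h2; rewrite ?sq_ltE //; lia.
- move=> h; have -> : (sq d l0 < sq d l) = false.
    by rewrite sq_ltE; move: h; have := @sq_le_sub d 0 l0; rewrite leNgt sq_ltE /mbound; lia.
  rewrite sq_large; lia.
Qed.

Lemma inm_mdel d P Q : inm d P -> inm (mdel d P) Q = inm d Q && (Q != P).
Proof.
move=> /inmP[l0 <-]; apply/inmP/idP => [[l <-]|/andP[/inmP[l <-] ne]].
- rewrite sq_mdel; case: ltnP => h; rewrite inm_sq (inj_eq (@sq_inj d)) /=; lia.
- have : l != l0 by rewrite -(inj_eq (@sq_inj d)).
  case: (ltngtP l l0) => // h _; first by exists l; rewrite sq_mdel h.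
  by exists l.-1; rewrite sq_mdel; case: ltnP => h'; [lia|congr sq; lia].
Qed.

Lemma charge_mdel d P : (mdel d P).1 = d.1 - 1. Proof. by []. Qed.
Lemma charge_mins d P : (mins d P).1 = d.1 + 1. Proof. by []. Qed.

Lemma sq_mins d P l : ~~ inm d P ->
  sq (mins d P) l = if P < sq d l then sq d l
              else if (l == 0)%N || (P < sq d l.-1) then P else sq d l.-1.
Proof.
move=> nP; have ne k : sq d k != P by apply: contra nP => /eqP<-; exact: inm_sq.
rewrite sq_mk // => {}l.
- have := ne l; have := ne l.+1; have := ne l.-1.
  have := sq_dec d l; have : (l == 0)%N \/ sq d l < sq d l.-1.
    by case: l => [|l]; [left|right; exact: sq_dec].
  by case: (ltP P (sq d l.+1)); case: (ltP P (sq d l)); case: (ltP P (sq d l.-1)); case: (l == 0)%N => /=; lia.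
- move=> h; have hl : sq d (size (val d.2)) < P.
    by rewrite ltNge; apply: contra nP; rewrite sq_large //; exact: inm_low.
  have hl1 : sq d l.-1 <= sq d (size (val d.2)) by rewrite leNgt sq_ltE; lia.
  have hl2 : sq d l <= sq d l.-1 by rewrite leNgt sq_ltE; lia.
  have -> : P < sq d l = false by lia.
  have -> : P < sq d l.-1 = false by lia.
  have -> : (l == 0)%N = false by lia.
  by rewrite /= sq_large; lia.
Qed.

Lemma inm_mins d P Q : ~~ inm d P -> inm (mins d P) Q = inm d Q || (Q == P).
Proof.
move=> nP; have ne k : sq d k != P by apply: contra nP => /eqP<-; exact: inm_sq.
apply/inmP/orP => [[l <-]|[/inmP[l <-]|/eqP ->]].
- by rewrite sq_mins //; do 2?case: ifP => _; rewrite ?inm_sq ?eqxx; auto.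
- have [h|h] := ltP P (sq d l); first by exists l; rewrite sq_mins // h.
  exists l.+1; rewrite sq_mins //=.
  have -> : P < sq d l.+1 = false by have := sq_dec d l; lia.
  have -> // : P < sq d l = false by lia.
- have ex : exists l, sq d l < P.
    by exists (size (val d.2)); rewrite ltNge; apply: contra nP; rewrite sq_large //; exact: inm_low.
  have := ex_minnP ex => -[m hm mmin]; exists m; rewrite sq_mins //.
  have -> : P < sq d m = false by lia.
  case: m hm mmin => //= m hm mmin.
  have -> // : P < sq d m.
  by have := ne m; have := mmin m; have := ltnn m; lia.
Qed.

Lemma mdel_comm d P Q : inm d P -> inm d Q -> P != Q ->
  mdel (mdel d P) Q = mdel (mdel d Q) P.
Proof.
move=> hP hQ ne; apply: maya_ext => x.
rewrite !inm_mdel ?hP ?hQ ?ne ?(eq_sym Q P) ?ne //.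
by rewrite -!andbA [(_ != _) && _]andbC.
Qed.

Lemma mins_comm d P Q : ~~ inm d P -> ~~ inm d Q -> P != Q ->
  mins (mins d P) Q = mins (mins d Q) P.
Proof.
move=> hP hQ ne; apply: maya_ext => x.
rewrite !inm_mins ?inm_mins ?negb_or ?hP ?hQ ?ne ?(eq_sym Q P) ?ne //.
by rewrite -!orbA [(_ == _) || _]orbC.
Qed.

Lemma mdelK d P : inm d P -> mins (mdel d P) P = d.
Proof.
move=> hP; apply: maya_ext => x.
rewrite inm_mins inm_mdel ?hP ?eqxx ?andbF //.
by case: eqP => [->|]; rewrite ?orbT ?hP // orbF andbT.
Qed.

Lemma minsK d P : ~~ inm d P -> mdel (mins d P) P = d.
Proof.
move=> hP; apply: maya_ext => x.
rewrite inm_mdel inm_mins ?hP ?eqxx ?orbT //.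
by case: eqP => [->|]; rewrite ?andbF ?(negbTE hP) // orbF andbT.
Qed.

Lemma mins_mdel d P Q : inm d P -> ~~ inm d Q ->
  mins (mdel d P) Q = mdel (mins d Q) P.
Proof.
move=> hP hQ; have ne : P != Q by apply: contraNneq hQ => <-.
apply: maya_ext => x.
rewrite inm_mins ?inm_mdel ?inm_mins ?hP ?(negbTE hQ) //.
by case: (eqVneq x Q) => [->|]; rewrite ?orbT ?(eq_sym Q P) ?ne ?orbF.
Qed.

(** The summation range of [above] depends on the diagram. A window of positions common to two
    diagrams lets their counts be compared term by term. *)
Lemma above_window d P M : sq d 0 <= P + M%:Z ->
  above d P = (\sum_(Q <- [seq (P + 1 + i%:Z)%R | i <- iota 0 M]) inm d Q)%N.
Proof.
move=> hM; rewrite /above.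
transitivity (\sum_(Q <- [seq sq d l | l <- iota 0 (mbound d P)]) (inm d Q && (P < Q)%R : nat))%N.
  rewrite big_map -(big_mkord xpredT (fun l => nat_of_bool (P < sq d l))) /index_iota subn0.
  by apply: eq_bigr => l _; rewrite inm_sq.
rewrite (@sum_support _ int _ [seq (P + 1 + i%:Z)%R | i <- iota 0 M]).
- rewrite !big_map; apply: eq_bigr => i _.
  have -> : P < P + 1 + i%:Z by lia.
  by rewrite andbT.
- by rewrite map_inj_uniq ?iota_uniq //; exact: sq_inj.
- by rewrite map_inj_uniq ?iota_uniq // => i j; lia.
- move=> Q; case: (inmP d Q) => // -[l <-]; case: ltP => // Pl _.
  have := @sq_le_sub d 0 l; rewrite leNgt sq_ltE => /(_ isT) h.
  apply/idP/idP => _; apply/mapP.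
  + by exists (absz (sq d l - P - 1)%R); rewrite ?mem_iota; lia.
  + by exists l => //; rewrite mem_iota /mbound; lia.
Qed.

Definition sg (R : pzRingType) (d : maya) P : R := (-1) ^+ above d P.

Lemma sg_mdel (R : pzRingType) d P Q : inm d P ->
  sg R (mdel d P) Q = (if Q < P then -1 else 1) * sg R d Q.
Proof.
move=> hP; rewrite /sg; set M := (absz (sq d 0 - Q) + absz (sq (mdel d P) 0 - Q) + absz (P - Q))%N.
rewrite (@above_window d Q M) ?(@above_window _ Q M); try lia.
set r := map _ _; have ur : uniq r by rewrite map_inj_uniq ?iota_uniq // => i j; lia.
under eq_bigr => x _ do rewrite inm_mdel //.
have [QP|PQ] := ltP Q P.
- have Pr : P \in r by apply/mapP; exists (absz (P - Q - 1)%R); rewrite ?mem_iota; lia.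
  rewrite (bigD1_seq P) //= [in RHS](bigD1_seq P) //= hP eqxx /= add0n exprS mulN1r mulN1r opprK.
  by congr (_ ^+ _); apply: eq_bigr => i ne; rewrite ne andbT.
- rewrite mul1r; congr (_ ^+ _); apply: eq_big_seq => x /mapP[i _ ->].
  have -> : Q + 1 + i%:Z != P by lia.
  by rewrite andbT.
Qed.

Lemma sg_mins (R : pzRingType) d P Q : ~~ inm d P ->
  sg R (mins d P) Q = (if Q < P then -1 else 1) * sg R d Q.
Proof.
move=> hP; rewrite -{2}(minsK hP) sg_mdel ?inm_mins ?eqxx ?orbT // mulrA.
by case: ifP => _; rewrite ?mulrNN ?mulr1 ?mul1r.
Qed.

End Maya.

(** * Power series exponentials and derivatives of rational functions *)

Section Convolution.
Variable F : comNzRingType.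
Implicit Types a b c : nat -> F.

Definition conv a b (k : nat) : F := \sum_(r < k.+1) a r * b (k - r)%N.
Definition conv1 (k : nat) : F := (k == 0)%:R.

Let trunc M a : {poly F} := \poly_(r < M) a r.

Let convE M a b k : (k < M)%N -> conv a b k = (trunc M a * trunc M b)`_k.
Proof.
move=> kM; rewrite coefM; apply: eq_bigr => r _; have := ltn_ord r => rk.
by rewrite !coef_poly !ifT //; lia.
Qed.

Lemma convC a b : conv a b = conv b a.
Proof. by apply/funext => k; rewrite !(@convE k.+1) // mulrC. Qed.

Lemma convA a b c : conv a (conv b c) = conv (conv a b) c.
Proof.
apply/funext => k; transitivity ((trunc k.+1 a * trunc k.+1 b * trunc k.+1 c)`_k).
  rewrite -mulrA coefM; apply: eq_bigr => r _; have := ltn_ord r => rk.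
  by rewrite -(@convE k.+1) ?coef_poly ?ifT //; lia.
rewrite coefM; apply: eq_bigr => r _; have := ltn_ord r => rk.
by rewrite -(@convE k.+1) ?coef_poly ?ifT //; lia.
Qed.

Lemma conv1l a : conv conv1 a = a.
Proof.
apply/funext => k; rewrite /conv big_ord_recl /= /conv1 eqxx mul1r subn0.
by rewrite big1 ?addr0 // => r _; rewrite mul0r.
Qed.

Lemma convNl a c k : conv (fun r => - a r) c k = - conv a c k.
Proof. by rewrite -sumrN; apply: eq_bigr => r _; rewrite mulNr. Qed.

Lemma convDr a b c k : conv c (fun r => a r + b r) k = conv c a k + conv c b k.
Proof. by rewrite -big_split; apply: eq_bigr => r _; rewrite mulrDr. Qed.

Lemma convZr (x : F) a c k : conv c (fun r => x * a r) k = x * conv c a k.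
Proof. by rewrite mulr_sumr; apply: eq_bigr => r _; rewrite mulrCA. Qed.

(** The Leibniz rule for t d/dt, read on coefficients. *)
Lemma conv_deriv a b k :
  k%:R * conv a b k = conv (fun r => r%:R * a r) b k + conv a (fun r => r%:R * b r) k.
Proof.
rewrite mulr_sumr -big_split; apply: eq_bigr => r _; have := ltn_ord r => rk /=.
by rewrite {1}(_ : k = r + (k - r))%N ?natrD; [ring | lia].
Qed.

End Convolution.

Section ExpSeries.
Variable F : numFieldType.
Implicit Types y : nat -> F.

(* [hseq y] is the coefficient sequence of the power series exp (sum_(k >= 1) y_k t^k). *)
Fixpoint hlist y m : seq F := match m with
  | 0 => [:: 1]
  | m'.+1 => let l := hlist y m' in
     (m'.+1%:R^-1 * \sum_(r < m'.+1) r.+1%:R * y r.+1 * nth 0 l r) :: l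
  end.
Definition hseq y m := head 0 (hlist y m).

Lemma nth_hlist y m r : (r <= m)%N -> nth 0 (hlist y m) r = hseq y (m - r).
Proof.
elim: m r => [|m IH] [|r] //= rm.
by rewrite subSS IH.
Qed.

Lemma hseq0 y : hseq y 0 = 1. Proof. by []. Qed.

Lemma hseqS y m :
  m.+1%:R * hseq y m.+1 = \sum_(r < m.+1) r.+1%:R * y r.+1 * hseq y (m - r).
Proof.
rewrite /hseq /= mulVKf ?pnatr_eq0 //; apply: eq_bigr => r _.
by rewrite nth_hlist // -ltnS.
Qed.

Lemma hseq_deriv y k : k%:R * hseq y k = conv (fun r => r%:R * y r) (hseq y) k.
Proof.
rewrite /conv big_ord_recl !mul0r add0r; case: k => [|k]; first by rewrite big_ord0 mul0r.
by rewrite hseqS; apply: eq_bigr => r _; rewrite lift0 subSS.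
Qed.

(** By [conv_deriv] and [hseq_deriv] the operator t d/dt kills the product, so only the constant
    coefficient remains. *)
Lemma hseq_inv y : conv (hseq (fun k => - y k)) (hseq y) = @conv1 F.
Proof.
apply/funext => -[|k]; first by rewrite /conv big_ord1 !hseq0 mulr1.
have k1 : k.+1%:R != 0 :> F by rewrite pnatr_eq0.
apply: (mulfI k1); rewrite /conv1 mulr0 conv_deriv.
under [X in conv X _ _ + _]eq_fun => r do rewrite hseq_deriv.
under [X in _ + conv _ X _]eq_fun => r do rewrite hseq_deriv.
rewrite convA [conv (hseq _) (fun _ => _)]convC -[conv (conv (fun r => r%:R * y r) _) _]convA.
rewrite -convA.
set A := conv (hseq _) (hseq y).
rewrite (_ : (fun r => r%:R * - y r) = fun r => - (r%:R * y r)); last by apply/funext => r; rewrite mulrN.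
by rewrite convNl addNr.
Qed.

(** For an odd exponent, replacing t by -t inverts the exponential. This is where setting the even
    times to 0 enters. *)
Lemma hseq_odd y m : (forall k, ~~ odd k -> y k = 0) ->
  hseq (fun k => - y k) m = (-1) ^+ m * hseq y m.
Proof.
move=> hy; elim/ltn_ind: m => -[|m] IH; first by rewrite !hseq0 mulr1.
have m1 : m.+1%:R != 0 :> F by rewrite pnatr_eq0.
apply: (mulfI m1); rewrite [RHS]mulrCA !hseqS mulr_sumr; apply: eq_bigr => r _.
have rm := ltn_ord r; rewrite IH; last by lia.
have [od|ev] := boolP (odd r.+1); last by rewrite hy // oppr0 !(mulr0, mul0r).
have -> : (-1) ^+ m.+1 = - (-1) ^+ (m - r) :> F.
  rewrite (congr1 (GRing.exp (-1)) (_ : m.+1 = r.+1 + (m - r)%N)%N); last by lia.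
  by rewrite exprD -signr_odd od expr1 mulN1r.
by ring.
Qed.

End ExpSeries.

Section PolyDerivative.
Variable F : numFieldType.
Implicit Types (phi psi : F -> F) (d : F).

(** Derivative at 0 of a polynomial function, as a relation: everything differentiated below is
    polynomial in the increment h, and a polynomial is determined by its values in characteristic 0,
    so d is unique. *)
Definition is_pder phi d := exists2 p : {poly F}, (forall h, phi h = p.[h]) & p^`().[0] = d.

Lemma poly_ext (p q : {poly F}) : (forall h, p.[h] = q.[h]) -> p = q.
Proof.
move=> e; apply/eqP; rewrite -subr_eq0; apply/eqP.
apply: (@roots_geq_poly_eq0 _ _ [seq k%:R | k <- iota 0 (size (p - q))]).
- by apply/allP => x _; rewrite /root hornerD hornerN e subrr.
- by rewrite map_inj_uniq ?iota_uniq // => i j /eqP; rewrite eqr_nat => /eqP.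
- by rewrite size_map size_iota.
Qed.

Lemma is_pder_uniq phi d d' : is_pder phi d -> is_pder phi d' -> d = d'.
Proof.
move=> [p e <-] [q e' <-]; rewrite (@poly_ext p q) // => h; rewrite -e; exact: e'.
Qed.

Lemma is_pder_cst c : is_pder (fun=> c) 0.
Proof. by exists c%:P => [h|]; rewrite ?hornerC // derivC horner0. Qed.

Lemma is_pderD phi psi d d' : is_pder phi d -> is_pder psi d' ->
  is_pder (fun h => phi h + psi h) (d + d').
Proof.
by move=> [p e <-] [q e' <-]; exists (p + q) => [h|]; rewrite ?derivD hornerD ?e ?e'.
Qed.

Lemma is_pderM phi psi d d' : is_pder phi d -> is_pder psi d' ->
  is_pder (fun h => phi h * psi h) (d * psi 0 + phi 0 * d').
Proof.
move=> [p e <-] [q e' <-]; exists (p * q) => [h|]; first by rewrite hornerM e e'.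
by rewrite derivM hornerD !hornerM e e'.
Qed.

Lemma is_pderZ c phi d : is_pder phi d -> is_pder (fun h => c * phi h) (c * d).
Proof. by move=> h; have := is_pderM (is_pder_cst c) h; rewrite mul0r add0r. Qed.

Lemma is_pderN phi d : is_pder phi d -> is_pder (fun h => - phi h) (- d).
Proof.
move=> h; rewrite -mulN1r (_ : (fun h => - phi h) = fun h => -1 * phi h); first exact: is_pderZ.
by apply/funext => z; rewrite mulN1r.
Qed.

Lemma is_pder_opp phi d : is_pder phi d -> is_pder (fun h => phi (- h)) (- d).
Proof.
move=> [p e <-]; exists (p \Po (- 'X)) => [h|]; first by rewrite e horner_comp hornerN hornerX.
by rewrite deriv_comp derivN derivX mulrN1 hornerN horner_comp hornerN hornerX oppr0.
Qed.

Lemma is_pder_sum (T : Type) (r : seq T) (P : pred T) (phi : T -> F -> F) (d : T -> F) :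
  (forall x, is_pder (phi x) (d x)) ->
  is_pder (fun h => \sum_(x <- r | P x) phi x h) (\sum_(x <- r | P x) d x).
Proof.
move=> H; elim: r => [|x r IH].
  rewrite big_nil (_ : (fun h => _) = fun=> 0); first exact: is_pder_cst.
  by apply/funext => h; rewrite big_nil.
rewrite big_cons (_ : (fun h => _) = fun h =>
    if P x then phi x h + \sum_(x <- r | P x) phi x h else \sum_(x <- r | P x) phi x h); last first.
  by apply/funext => h; rewrite big_cons.
by case: (P x) => //; apply: is_pderD.
Qed.

(** Differentiating the exponential in y_1 multiplies it by t. *)
Lemma is_pder_hseq (y : nat -> F) k :
  is_pder (fun h => hseq (fun m => y m + (m == 1)%:R * h) k) (if k is k'.+1 then hseq y k' else 0).
Proof.
elim/ltn_ind: k => -[_|k IH]; first exact: is_pder_cst.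
have k1 : k.+1%:R != 0 :> F by rewrite pnatr_eq0.
have -> : (fun h => hseq (fun m => y m + (m == 1)%:R * h) k.+1) =
    fun h => k.+1%:R^-1 * \sum_(r < k.+1) (r.+1%:R * (y r.+1 + (r.+1 == 1)%:R * h)) *
       hseq (fun m => y m + (m == 1)%:R * h) (k - r).
  by apply/funext => h; rewrite -hseqS mulKf.
have pX : is_pder id 1 by exists 'X => [h|]; rewrite ?hornerX // derivX hornerC.
(* The product rule applied to the recursion [hseqS]. The first summands vanish except at r = 0,
   which gives [hseq y k]; the second ones add up to k times [hseq y k] by the recursion one step
   lower. *)
have -> : hseq y k = k.+1%:R^-1 * \sum_(r < k.+1) ((r.+1%:R * (0 + (r.+1 == 1)%:R * 1)) * hseq y (k - r)
   + (r.+1%:R * y r.+1) * (if (k - r)%N is k'.+1 then hseq y k' else 0)).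
  apply: (mulfI k1); rewrite mulVKf // big_split /= big_ord_recl /= subn0 !add0r !mulr1 mul1r.
  rewrite big1 ?addr0 => [|r _]; last by rewrite /= !(mulr0, mul0r, add0r).
  rewrite big_ord_recr /= subnn mulr0 addr0 -natr1 mulrDl mul1r addrC; congr (_ + _).
  case: k {IH k1} => [|k]; first by rewrite big_ord0 mul0r.
  rewrite hseqS; apply: eq_bigr => r _; have := ltn_ord r => rk.
  by rewrite (_ : (k.+1 - r)%N = (k - r).+1) //; lia.
apply/is_pderZ/is_pder_sum => r.
have hr := IH (k - r)%N (leq_ltn_trans (leq_subr _ _) (ltnSn k)).
have := is_pderM (is_pderZ r.+1%:R (is_pderD (is_pder_cst (y r.+1)) (is_pderZ (r.+1 == 1)%:R pX))) hr.
rewrite mulr0 addr0 (_ : (fun m => y m + _) = y) //.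
by apply/funext => m; rewrite mulr0 addr0.
Qed.

End PolyDerivative.

Lemma rderiv0_frac (R : realType) (phi N D : R[i] -> R[i]) (dN dD : R[i]) :
  is_pder N dN -> is_pder D dD -> D 0 != 0 ->
  (forall h, D h != 0 -> phi h = N h / D h) ->
  rderiv0 phi = (dN * D 0 - N 0 * dD) / D 0 ^+ 2.
Proof.
move=> [p pE dp] [q qE dq] D0 hphi; rewrite /rderiv0.
set pq := ClassicalEpsilon.epsilon _ _.
have [/= q0 rep] : rat_rep phi pq.
  apply: ClassicalEpsilon.epsilon_spec; exists (p, q); split; first by rewrite -qE.
  by move=> h /=; rewrite -qE => /hphi ->; rewrite pE.
(* The two fractions are compared only where both denominators are nonzero; multiplying by the
   denominators makes the identity trivial at the other points. *)
have e : pq.1 * q = p * pq.2.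
  apply: (@mulIf _ (pq.2 * q)).
    by rewrite mulf_neq0 //; [apply: contraNneq q0 | apply: contraNneq D0; rewrite qE] => ->; rewrite horner0.
  apply: poly_ext => h; rewrite !hornerM.
  have [->|a0] := eqVneq pq.2.[h] 0; first by rewrite !(mul0r, mulr0).
  have [->|b0] := eqVneq q.[h] 0; first by rewrite !(mul0r, mulr0).
  congr (_ * _); have := rep h a0; rewrite hphi ?qE // pE => e.
  have := congr1 (fun z => z * q.[h] * pq.2.[h]) e; rewrite divfK // mulrAC divfK //.
have e0 := congr1 (fun r : {poly _} => r.[0]) e.
have e1 := congr1 (fun r : {poly _} => r^`().[0]) e.
move: e0 e1; rewrite /= !derivM !hornerD !hornerM dp dq -!qE -!pE => e0 e1.
have {}e0 : pq.1.[0] = N 0 * pq.2.[0] / D 0 by apply: (canRL (mulfK D0)).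
have {}e1 : (pq.1)^`().[0] = (dN * pq.2.[0] + N 0 * (pq.2)^`().[0] - pq.1.[0] * dD) / D 0.
  by apply: (canRL (mulfK D0)); rewrite -e1 addrK.
by rewrite e1 e0; field; rewrite D0 q0.
Qed.

(** * Canonical anticommutation relations *)

Section CAR.
Variable R : realType.
Local Notation C := (R[i]).
Implicit Types (f g : Fock R) (d : maya) (P Q : int).

Lemma focklinE (c : C) f g : (fun d => c * f d + g d) = c *: f + g.
Proof. by []. Qed.

Lemma wedgeE P f d : wedge P f d = if inm d P then sg C d P * f (mdel d P) else 0.
Proof. by []. Qed.

Lemma contrE P f d : contr P f d = if inm d P then 0 else sg C d P * f (mins d P).
Proof. by []. Qed.

Lemma wedge_is_linear P : linear (@wedge R P : Fock R -> Fock R).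
Proof.
move=> c f g; apply/funext => d; rewrite -!focklinE !wedgeE.
by case: ifP => _; [ring | rewrite mulr0 addr0].
Qed.
HB.instance Definition _ P := GRing.isLinear.Build C (Fock R) (Fock R) *:%R (@wedge R P) (wedge_is_linear P).

Lemma contr_is_linear P : linear (@contr R P : Fock R -> Fock R).
Proof.
move=> c f g; apply/funext => d; rewrite -!focklinE !contrE.
by case: ifP => _; [rewrite mulr0 addr0 | ring].
Qed.
HB.instance Definition _ P := GRing.isLinear.Build C (Fock R) (Fock R) *:%R (@contr R P) (contr_is_linear P).

Lemma wedgeC P Q f : wedge P (wedge Q f) = - wedge Q (wedge P f).
Proof.
apply/funext => d; rewrite -[RHS]/(- (wedge Q (wedge P f) d)) !wedgeE.
have [hP|hP] := boolP (inm d P); have [hQ|hQ] := boolP (inm d Q);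
  rewrite ?(negbTE hP) ?(negbTE hQ) ?hP ?hQ ?inm_mdel ?inm_mdel ?hP ?hQ ?(negbTE hP) ?(negbTE hQ) //= ?mulr0 ?oppr0 //.
have [->|ne] := eqVneq Q P; first by rewrite /= !mulr0 oppr0.
rewrite /= !sg_mdel // mdel_comm // 1?eq_sym //.
case: (ltgtP P Q) ne => // _ _; ring.
Qed.

Lemma contrC P Q f : contr P (contr Q f) = - contr Q (contr P f).
Proof.
apply/funext => d; rewrite -[RHS]/(- (contr Q (contr P f) d)) !contrE.
have [hP|hP] := boolP (inm d P); have [hQ|hQ] := boolP (inm d Q);
  rewrite ?(negbTE hP) ?(negbTE hQ) ?hP ?hQ ?inm_mins ?inm_mins ?hP ?hQ ?(negbTE hP) ?(negbTE hQ) //= ?mulr0 ?oppr0 //.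
have [->|ne] := eqVneq Q P; first by rewrite /= !mulr0 oppr0.
rewrite /= !sg_mins // mins_comm // 1?eq_sym //.
case: (ltgtP P Q) ne => // _ _; ring.
Qed.

Lemma sgK d P : sg C d P * sg C d P = 1.
Proof. by rewrite /sg -exprD addnn -mul2n exprM sqrrN expr1n expr1n. Qed.

Lemma wedge_contr P Q f :
  wedge P (contr Q f) = (P == Q)%:R *: f - contr Q (wedge P f).
Proof.
apply/funext => d; rewrite -[RHS]/((P == Q)%:R * f d - (contr Q (wedge P f) d)) wedgeE contrE.
rewrite contrE wedgeE.
have [<-|ne] := eqVneq P Q.
  have [hP|hP] := boolP (inm d P).
    rewrite inm_mdel // eqxx andbF sg_mdel // ltxx mdelK //.
    by rewrite mul1r mulrA sgK /=; ring.
  rewrite inm_mins // eqxx orbT sg_mins // ltxx minsK //.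
  by rewrite mul1r mulrA sgK /=; ring.
rewrite mul0r add0r.
have [hP|hP] := boolP (inm d P); have [hQ|hQ] := boolP (inm d Q);
  rewrite ?(negbTE hP) ?(negbTE hQ) ?hP ?hQ ?inm_mdel ?inm_mins ?hP ?hQ ?(negbTE hP) ?(negbTE hQ) //=
    ?(eq_sym Q P) ?(negbTE ne) ?mulr0 ?oppr0 //.
rewrite sg_mdel // sg_mins // mins_mdel //.
case: (ltgtP P Q) ne => // _ _; ring.
Qed.

Lemma inm_vac P : inm (0, part0) P = (P <= 0).
Proof.
apply/idP/idP => [/inmP[l <-]|h]; first by rewrite /sq /= nth_nil; lia.
by apply: inm_low => /=; lia.
Qed.

Lemma vacE d : vac R d = (d == (0%Z, part0))%:R.
Proof. by rewrite /vac; case: eqP. Qed.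

Lemma wedge_vac P : P <= 0 -> wedge P (vac R) = 0.
Proof.
move=> hP; apply/funext => d; rewrite wedgeE vacE; case: ifP => // inP.
case: eqP => [e|]; last by rewrite mulr0.
have : inm (mdel d P) P by rewrite e inm_vac.
by rewrite inm_mdel // eqxx andbF.
Qed.

Lemma contr_vac P : 0 < P -> contr P (vac R) = 0.
Proof.
move=> hP; apply/funext => d; rewrite contrE vacE; case: ifPn => // inP.
case: eqP => [e|]; last by rewrite mulr0.
have : inm (mins d P) P by rewrite inm_mins // eqxx orbT.
rewrite e inm_vac; lia.
Qed.

End CAR.

(** * Fermions, currents and the operators Q *)

Section Positions.
Variable n : nat.
Implicit Types (a b : 'I_n) (k : int).

Lemma pos_pred a k : pos a k - 1 = (- k - 1) * n%:Z + a%:Z.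
Proof. rewrite /pos; ring. Qed.

Lemma colz_pos a k : colz n (pos a k) = a%:Z.
Proof.
by rewrite /colz pos_pred modzMDl modz_small // lez_nat ltz_nat ltn_ord.
Qed.

Lemma tpow_pos a k : tpow n (pos a k) = k.
Proof.
rewrite /tpow pos_pred divzMDl; last by have := ltn_ord a; lia.
by rewrite divz_small ?lez_nat ?ltz_nat ?ltn_ord //; lia.
Qed.

Lemma pos_inj a b k l : pos a k = pos b l -> a = b /\ k = l.
Proof.
move=> e; split; last by rewrite -(tpow_pos a k) e tpow_pos.
by apply/val_inj/eqP; rewrite /= -eqz_nat -(colz_pos a k) e colz_pos.
Qed.

Lemma pos_eq a b k l : (pos a k == pos b l) = (a == b) && (k == l).
Proof.
by apply/eqP/andP => [/pos_inj[-> ->]|[/eqP -> /eqP ->]].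
Qed.

Lemma posD a k (m : nat) : pos a k - (n * m)%:Z = pos a (k + m%:Z).
Proof. by rewrite /pos PoszM; ring. Qed.

Lemma pos_le0 a k : (pos a k <= 0) = (0 <= k).
Proof. rewrite /pos; have := ltn_ord a; nia. Qed.

Lemma pos_colz a P : colz n P = a%:Z -> P = pos a (tpow n P).
Proof.
move=> h; have := divz_eq (P - 1) n%:Z; rewrite -/(colz n P) h /pos /tpow => e.
nia.
Qed.

Lemma posP (P : int) : (0 < n)%N -> exists a k, P = pos a k.
Proof.
move=> n0; have n0' : n%:Z != 0 by lia.
have h1 : (0 <= colz n P) by rewrite /colz modz_ge0.
have h2 : (colz n P < n%:Z) by rewrite /colz ltz_pmod //; lia.
have lt : (absz (colz n P) < n)%N by lia.
exists (Ordinal lt), (tpow n P); apply: pos_colz => /=; lia.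
Qed.

End Positions.

Section Fermions.
Variables (R : realType) (n : nat).
Local Notation C := (R[i]).
Implicit Types (f g : Fock R) (d : maya) (i j : 'I_n) (a b : int).

HB.instance Definition _ j a := GRing.isLinear.Build C (Fock R) (Fock R) *:%R (@psip R n j a) (wedge_is_linear (pos j a)).
HB.instance Definition _ j a := GRing.isLinear.Build C (Fock R) (Fock R) *:%R (@psim R n j a) (contr_is_linear (pos j a)).

Lemma psipC i j a b f : psip i a (psip j b f) = - psip j b (psip i a f).
Proof. exact: wedgeC. Qed.

Lemma psimC i j a b f : psim i a (psim j b f) = - psim j b (psim i a f).
Proof. exact: contrC. Qed.

Lemma psip_psim i j a b f :
  psip i a (psim j b f) = ((i == j) && (a == b))%:R *: f - psim j b (psip i a f).
Proof. by rewrite /psip /psim wedge_contr pos_eq. Qed.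

Lemma psim_psip i j a b f :
  psim i a (psip j b f) = ((i == j) && (a == b))%:R *: f - psip j b (psim i a f).
Proof. by rewrite psip_psim [i == j]eq_sym [a == b]eq_sym opprB addrC subrK. Qed.

Lemma psip_vac j a : 0 <= a -> psip j a (vac R) = 0.
Proof. by move=> h; apply: wedge_vac; rewrite pos_le0. Qed.

Lemma psim_vac j a : a < 0 -> psim j a (vac R) = 0.
Proof. by move=> h; apply: contr_vac; rewrite ltNge pos_le0 -ltNge. Qed.

(** Charge c vectors obtained from the vacuum by finitely many fermions. The predicate doubles as an
    induction principle for operators known only through their commutation with fermions, such as
    the Q_i. *)
Inductive FinC : int -> Fock R -> Prop :=
| FinC_vac : FinC 0 (vac R)
| FinC_psip c j a f : FinC c f -> FinC (c + 1) (psip j a f)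
| FinC_psim c j a f : FinC c f -> FinC (c - 1) (psim j a f)
| FinC_lin c (k : C) f g : FinC c f -> FinC c g -> FinC c (k *: f + g).

Lemma FinC0 c f : FinC c f -> FinC c 0.
Proof. by move=> h; rewrite -[0](addNr f) -scaleN1r; apply: FinC_lin. Qed.

Lemma FinCD c f g : FinC c f -> FinC c g -> FinC c (f + g).
Proof. by move=> hf hg; rewrite -[f]scale1r; apply: FinC_lin. Qed.

Lemma FinCZ c k f : FinC c f -> FinC c (k *: f).
Proof. by move=> hf; rewrite -[_ *: _]addr0; apply: FinC_lin => //; apply: FinC0 hf. Qed.

Lemma FinC_sum c (T : Type) (r : seq T) (F : T -> Fock R) :
  FinC c 0 -> (forall x, FinC c (F x)) -> FinC c (\sum_(x <- r) F x).
Proof.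
by move=> h0 hF; elim: r => [|x r IH]; rewrite ?big_nil // big_cons; apply: FinCD.
Qed.

(** Modes beyond K kill f, as happens for each single [FinC] vector; this makes the sum for a
    current finite. *)
Definition bnd (K : nat) f := forall j a,
  (K%:Z <= a -> psip j a f = 0) /\ (a < - K%:Z -> psim j a f = 0).

Lemma bnd_le K K' f : (K <= K')%N -> bnd K f -> bnd K' f.
Proof. by move=> le h j a; have [h1 h2] := h j a; split=> ?; [apply: h1|apply: h2]; lia. Qed.

Lemma FinC_bnd c f : FinC c f -> exists K, bnd K f.
Proof.
elim=> {c f} [|c j a f _ [K IH]|c j a f _ [K IH]|c k f g _ [K IHf] _ [K' IHg]].
- by exists 0%N => j a; split=> h; [apply: psip_vac|apply: psim_vac]; lia.
- exists (K + absz a).+1 => j' a'; have [h1 h2] := IH j' a'; split=> h.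
    by rewrite psipC h1 ?raddf0 ?oppr0 //; lia.
  rewrite psim_psip h2 ?raddf0 ?subr0; last by lia.
  have -> : (a' == a) = false by lia.
  by rewrite andbF scale0r ?subr0 ?addr0.
- exists (K + absz a).+1 => j' a'; have [h1 h2] := IH j' a'; split=> h.
    rewrite psip_psim h1 ?raddf0 ?subr0; last by lia.
    have -> : (a' == a) = false by lia.
    by rewrite andbF scale0r ?subr0 ?addr0.
  by rewrite psimC h2 ?raddf0 ?oppr0 //; lia.
- exists (maxn K K') => j a; have [h1 h2] := IHf j a; have [h3 h4] := IHg j a.
  split=> h; rewrite linearP /=.
    by rewrite h1 ?h3 ?scaler0 ?addr0 //; lia.
  by rewrite h2 ?h4 ?scaler0 ?addr0 //; lia.
Qed.

Definition irange (K : nat) : seq int := [seq p%:Z - K%:Z | p <- iota 0 (2 * K)].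

Lemma mem_irange K a : (a \in irange K) = (- K%:Z <= a < K%:Z).
Proof.
apply/mapP/idP => [[i hi e]|h]; first by move: hi; rewrite mem_iota; lia.
by exists (absz (a + K%:Z)); rewrite ?mem_iota; lia.
Qed.

Lemma uniq_irange K : uniq (irange K).
Proof. by rewrite map_inj_uniq ?iota_uniq // => i j; lia. Qed.

Lemma alpha_is_linear j m : linear (@alpha R n j m : Fock R -> Fock R).
Proof.
move=> c f g; apply/funext => d; rewrite -!focklinE /alpha.
rewrite mulr_sumr -big_split /=; apply: eq_bigr => l _.
by do 2?case: ifP => _; rewrite ?mulr0 ?addr0 // mulrDr mulrCA.
Qed.
HB.instance Definition _ j m := GRing.isLinear.Build C (Fock R) (Fock R) *:%R (@alpha R n j m) (alpha_is_linear j m).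

(** [alpha] is defined coefficientwise with a window depending on the diagram; here it becomes one
    finite sum of operators, the form needed for commutators. *)
Lemma alphaE j m f (r : seq int) : (0 < n)%N -> (0 < m)%N -> uniq r ->
  (forall a, psip j a (psim j (a + m%:Z) f) != 0 -> a \in r) ->
  alpha j m f = \sum_(a <- r) psip j a (psim j (a + m%:Z) f).
Proof.
move=> n0 m0 ur hr; apply/funext => d; rewrite fct_sumE.
pose T P : C := if colz n P == j%:Z then
   (wedge P (contr (P - (n * m)%:Z) f) : Fock R) d else 0.
have Tpos a : T (pos j a) = (psip j a (psim j (a + m%:Z) f) : Fock R) d.
  by rewrite /T colz_pos eqxx posD.
transitivity (\sum_(P <- [seq sq d l | l <- iota 0 (size (val d.2) + n * m + 1)]) T P).
  rewrite big_map /alpha.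
  have -> L : \sum_(l <- iota 0 L) T (sq d l) = \sum_(l < L) T (sq d l).
    by rewrite -(big_mkord xpredT (fun l => T (sq d l))) /index_iota subn0.
  apply: eq_bigr => l _; rewrite /T; case: ifP => // _.
  rewrite wedgeE inm_sq contrE; case: ifP => _; first by rewrite mulr0.
  by rewrite /sg exprD mulrA.
transitivity (\sum_(P <- [seq pos j a | a <- r]) T P); last first.
  by rewrite big_map; apply: eq_bigr => a _; rewrite Tpos.
apply: sum_support.
- by rewrite map_inj_uniq ?iota_uniq //; exact: sq_inj.
- by rewrite map_inj_uniq // => a b /pos_inj[].
- move=> P TP; apply/idP/idP => _; apply/mapP.
    have cP : colz n P = j%:Z by move: TP; rewrite /T; case: (colz n P =P _) => // _; rewrite eqxx.
    rewrite (pos_colz cP) in TP *; exists (tpow n P) => //; apply: hr.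
    by apply: contraNneq TP; rewrite Tpos => ->.
  have : inm d P by move: TP; rewrite /T wedgeE; case: ifP; case: inm; rewrite ?eqxx.
  move=> /inmP[l e]; exists l; rewrite // mem_iota leq0n add0n andTb ltnNge; apply: contraNN TP => hl.
  apply/eqP; rewrite /T; case: ifP => // _; rewrite wedgeE; case: ifP => // inP.
  rewrite contrE inm_mdel //.
  (* Beyond the window the diagram has no gaps, so the target position is still occupied and the
     contraction gives 0. *)
  have -> : inm d (P - (n * m)%:Z).
    apply/inmP; exists (l + n * m)%N; rewrite -e !sq_large; lia.
  have -> : P - (n * m)%:Z != P by nia.
  by rewrite mulr0.
Qed.

Lemma alpha_irange K j m f : (0 < n)%N -> (0 < m)%N -> bnd K f ->
  forall K', (K + m <= K')%N ->
  alpha j m f = \sum_(a <- irange K') psip j a (psim j (a + m%:Z) f).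
Proof.
move=> n0 m0 hK K' le; apply: alphaE => //; first exact: uniq_irange.
move=> a; apply: contraR; rewrite mem_irange => out; apply/eqP.
have [le1|le1] := lerP K%:Z a.
  have [h _] := hK j a; rewrite psip_psim h // raddf0 subr0.
  have -> : (a == a + m%:Z) = false by lia.
  by rewrite andbF scale0r.
have [_ h] := hK j (a + m%:Z); rewrite h ?raddf0 //; lia.
Qed.

Section Commutation.
Hypothesis n0 : (0 < n)%N.

Lemma FinC_zero c : FinC c 0.
Proof.
have step c' : FinC c' 0 -> FinC (c' + 1) 0 /\ FinC (c' - 1) 0.
  move=> h; have := FinC_psip (Ordinal n0) 0 h; have := FinC_psim (Ordinal n0) 0 h.
  by rewrite !raddf0.
elim/int_ind: c => [|p|p].
- exact: FinC0 FinC_vac.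
- by move=> /step[]; rewrite -addn1 PoszD.
- by move=> /step[_]; rewrite -addn1 PoszD opprD.
Qed.

Lemma FinC_alpha c j m f : (0 < m)%N -> FinC c f -> FinC c (alpha j m f).
Proof.
move=> m0 hf; have [K hK] := FinC_bnd hf.
rewrite (alpha_irange _ n0 m0 hK (leqnn _)); apply: FinC_sum; first exact: FinC_zero.
by move=> a; rewrite -[c](subrK 1); apply/FinC_psip/FinC_psim.
Qed.

(** The current acts on fermions of its own colour as multiplication by t^(-m), and on dual fermions
    by the negative transpose. The spanning argument rests on these two commutators, the vertex
    relation on the first. *)
Lemma alpha_psip c i m j b f : (0 < m)%N -> FinC c f ->
  alpha i m (psip j b f) = psip j b (alpha i m f) + (i == j)%:R *: psip j (b - m%:Z) f.
Proof.
move=> m0 hf; have [K hK] := FinC_bnd hf.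
have [K' hK'] := FinC_bnd (FinC_psip j b hf).
pose L := (K + K' + absz b + m + m).+1.
rewrite (alpha_irange _ n0 m0 hK (K' := L)); last by rewrite /L; lia.
rewrite (alpha_irange _ n0 m0 hK' (K' := L)); last by rewrite /L; lia.
rewrite raddf_sum /= (eq_bigr (fun a => psip j b (psip i a (psim i (a + m%:Z) f)) +
   ((i == j) && (a + m%:Z == b))%:R *: psip i a f)); last first.
  by move=> a _; rewrite psim_psip linearB linearZ /= [in X in _ - X]psipC opprK addrC.
rewrite big_split /=; congr (_ + _).
have bL : b - m%:Z \in irange L by rewrite mem_irange /L; lia.
rewrite (bigD1_seq (b - m%:Z)) ?uniq_irange //= big1 ?addr0 => [|a ne].
  by rewrite subrK eqxx andbT; case: eqP => [->|]; rewrite // !scale0r.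
have -> : (a + m%:Z == b) = false by lia.
by rewrite andbF scale0r.
Qed.

Lemma alpha_psim c i m j b f : (0 < m)%N -> FinC c f ->
  alpha i m (psim j b f) = psim j b (alpha i m f) - (i == j)%:R *: psim j (b + m%:Z) f.
Proof.
move=> m0 hf; have [K hK] := FinC_bnd hf.
have [K' hK'] := FinC_bnd (FinC_psim j b hf).
pose L := (K + K' + absz b + m + m).+1.
rewrite (alpha_irange _ n0 m0 hK (K' := L)); last by rewrite /L; lia.
rewrite (alpha_irange _ n0 m0 hK' (K' := L)); last by rewrite /L; lia.
rewrite raddf_sum /= (eq_bigr (fun a => psim j b (psip i a (psim i (a + m%:Z) f)) -
   ((i == j) && (a == b))%:R *: psim i (a + m%:Z) f)); last first.
  by move=> a _; rewrite psimC linearN /= psip_psim opprB.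
rewrite big_split /=; congr (_ + _).
have bL : b \in irange L by rewrite mem_irange /L; lia.
rewrite sumrN; congr (- _).
rewrite (bigD1_seq b) ?uniq_irange //= big1 ?addr0 => [|a ne].
  by rewrite eqxx andbT; case: eqP => [->|]; rewrite // !scale0r.
by rewrite (negbTE ne) andbF scale0r.
Qed.

(** * The operators Q_i and their inverses *)

Variables (Q Qi : 'I_n -> Fock R -> Fock R).
Hypothesis HQ : Q_spec Q Qi.

Lemma QK i : cancel (Q i) (Qi i).
Proof. by have [h _ _ _ _] := HQ; have [] := h i. Qed.

Lemma QiK i : cancel (Qi i) (Q i).
Proof. by have [h _ _ _ _] := HQ; have [] := h i. Qed.

Lemma Q_is_linear i : linear (Q i).
Proof. by have [_ h _ _ _] := HQ; move=> c f g; exact: h. Qed.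
HB.instance Definition _ i := GRing.isLinear.Build C (Fock R) (Fock R) *:%R (Q i) (@Q_is_linear i).

Lemma Qi_is_linear i : linear (Qi i).
Proof. by move=> c f g; apply: (can_inj (@QK i)); rewrite linearP /= !QiK. Qed.
HB.instance Definition _ i := GRing.isLinear.Build C (Fock R) (Fock R) *:%R (Qi i) (@Qi_is_linear i).

Definition csg i j : C := if i == j then 1 else -1.

Lemma csgK i j : csg i j * csg i j = 1.
Proof. by rewrite /csg; case: ifP => _; rewrite ?mulrNN mul1r. Qed.

Lemma Q_vac i : Q i (vac R) = psip i (-1) (vac R).
Proof. by have [_ _ h _ _] := HQ. Qed.

Lemma Q_psip i j a f : Q i (psip j a f) = csg i j *: psip j (a - (i == j)%:Z) (Q i f).
Proof. by have [_ _ _ h _] := HQ. Qed.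

Lemma Q_psim i j a f : Q i (psim j a f) = csg i j *: psim j (a - (i == j)%:Z) (Q i f).
Proof. by have [_ _ _ _ h] := HQ. Qed.

Lemma Qi_psip i j a f : Qi i (psip j a f) = csg i j *: psip j (a + (i == j)%:Z) (Qi i f).
Proof.
by apply: (can_inj (@QK i)); rewrite QiK linearZ /= Q_psip QiK addrK scalerA csgK scale1r.
Qed.

Lemma Qi_psim i j a f : Qi i (psim j a f) = csg i j *: psim j (a + (i == j)%:Z) (Qi i f).
Proof.
by apply: (can_inj (@QK i)); rewrite QiK linearZ /= Q_psim QiK addrK scalerA csgK scale1r.
Qed.

(** [Q_spec] prescribes only Q_i on the vacuum; here Q_i carries psi^- at mode 0 to mode -1, which
    contracts the fermion that Q_i creates. *)
Lemma Qi_vac i : Qi i (vac R) = psim i 0 (vac R).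
Proof.
apply: (can_inj (@QK i)); rewrite QiK Q_psim /csg !eqxx scale1r Q_vac psim_psip !eqxx scale1r.
by rewrite psim_vac // raddf0 subr0.
Qed.

Lemma FinC_Q c i f : FinC c f -> FinC (c + 1) (Q i f).
Proof.
elim=> {c f} [|c j a f _ IH|c j a f _ IH|c k f g _ IHf _ IHg].
- by rewrite Q_vac; apply/FinC_psip/FinC_vac.
- by rewrite Q_psip; apply/FinCZ/FinC_psip.
- rewrite Q_psim; apply/FinCZ; have -> : c - 1 + 1 = c + 1 - 1 :> int by lia.
  exact: FinC_psim.
- by rewrite linearP; apply: FinC_lin.
Qed.

Lemma FinC_Qi c i f : FinC c f -> FinC (c - 1) (Qi i f).
Proof.
elim=> {c f} [|c j a f _ IH|c j a f _ IH|c k f g _ IHf _ IHg].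
- by rewrite Qi_vac; apply/FinC_psim/FinC_vac.
- rewrite Qi_psip; apply/FinCZ; have -> : c + 1 - 1 = c - 1 + 1 :> int by lia.
  exact: FinC_psip.
- by rewrite Qi_psim; apply/FinCZ/FinC_psim.
- by rewrite linearP; apply: FinC_lin.
Qed.

(** Q_i shifts both factors of each term by the same amount and the two signs cancel, so the sum is
    only reindexed. *)
Lemma Q_alpha c i j m f : (0 < m)%N -> FinC c f -> Q i (alpha j m f) = alpha j m (Q i f).
Proof.
move=> m0 hf; have [K hK] := FinC_bnd hf; have [K' hK'] := FinC_bnd (FinC_Q i hf).
pose L := (K + K' + m).+1.
rewrite (alpha_irange _ n0 m0 hK (K' := L)); last by rewrite /L; lia.
rewrite (alphaE (r := [seq a - (i == j)%:Z | a <- irange L])) //.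
- rewrite [RHS]big_map raddf_sum; apply: eq_bigr => a _.
  by rewrite [LHS]/= Q_psip Q_psim linearZ /= scalerA csgK scale1r addrAC.
- by rewrite map_inj_uniq ?uniq_irange // => a b; lia.
- move=> a; apply: contraR => out; apply/eqP.
  have out' : a \notin irange (K' + m).
    apply: contra out; rewrite mem_irange => h; apply/mapP.
    by exists (a + (i == j)%:Z); rewrite ?addrK // mem_irange /L; case: (i == j); lia.
  have [le1|le1] := lerP K'%:Z a.
    have [h _] := hK' j a; rewrite psip_psim h // raddf0 subr0.
    have -> : (a == a + m%:Z) = false by lia.
    by rewrite andbF scale0r.
  have [_ h] := hK' j (a + m%:Z); rewrite h ?raddf0 //.
  by move: out'; rewrite mem_irange; lia.
Qed.

Lemma Qi_alpha c i j m f : (0 < m)%N -> FinC c f -> Qi i (alpha j m f) = alpha j m (Qi i f).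
Proof.
by move=> m0 hf; apply: (can_inj (@QK i)); rewrite (Q_alpha i j m0 (FinC_Qi i hf)) !QiK.
Qed.

(** On the vacuum this is the anticommutation of two fermions; it extends because Q_i and Q_j pass
    through each fermion with scalars and shifts that commute. *)
Lemma QQ c i j f : i != j -> FinC c f -> Q i (Q j f) = - Q j (Q i f).
Proof.
move=> ne; elim=> {c f} [|c k a f _ IH|c k a f _ IH|c k f g _ IHf _ IHg].
- rewrite (Q_vac j) (Q_vac i) (Q_psip i j) (Q_psip j i) (Q_vac i) (Q_vac j) /csg (eq_sym j i) (negbTE ne) !subr0 !scaleN1r.
  by rewrite psipC opprK.
- rewrite ![Q _ (psip _ _ f)]Q_psip !linearZ /= !Q_psip IH raddfN !scalerN !scalerA /=.
  by rewrite mulrC addrAC.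
- rewrite ![Q _ (psim _ _ f)]Q_psim !linearZ /= !Q_psim IH raddfN !scalerN !scalerA /=.
  by rewrite mulrC addrAC.
- by rewrite !linearP /= IHf IHg.
Qed.

Lemma QiQ c i j f : i != j -> FinC c f -> Qi i (Q j f) = - Q j (Qi i f).
Proof.
move=> ne hf; apply: (can_inj (@QK i)); rewrite QiK raddfN /=.
by rewrite (QQ ne (FinC_Qi i hf)) QiK opprK.
Qed.

Lemma QiQi c i j f : i != j -> FinC c f -> Qi i (Qi j f) = - Qi j (Qi i f).
Proof.
move=> ne hf; apply: (can_inj (@QK i)); rewrite QiK raddfN /=.
apply: (can_inj (@QK j)); rewrite QiK raddfN /= [Q j (Q i _)](QQ _ (FinC_Qi j (FinC_Qi i hf))) 1?eq_sym //.
by rewrite !QiK opprK.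
Qed.

End Commutation.
End Fermions.

(** * Spanning by bosons and the vertex operator relation *)

Section Spanning.
Variables (R : realType) (n : nat).
Local Notation C := (R[i]).
Implicit Types (f g : Fock R) (d : maya) (i j : 'I_n) (a b : int).
Hypothesis n0 : (0 < n)%N.

Lemma alpha_vac j (r : nat) : alpha j r.+1 (vac R) =
  \sum_(q < r.+1) psip j (- 1 - q%:Z) (psim j (r%:Z - q%:Z) (vac R)).
Proof.
rewrite (alphaE (r := [seq - 1 - p%:Z | p <- iota 0 r.+1])) //.
- rewrite big_map -(big_mkord xpredT (fun q : nat => psip j (- 1 - q%:Z) (psim j (r%:Z - q%:Z) (vac R)))).
  rewrite /index_iota subn0; apply: eq_bigr => a _; congr (psip _ _ (psim _ _ _)); lia.
- by rewrite map_inj_uniq ?iota_uniq // => a b; lia.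
- move=> a; apply: contraR => out; apply/eqP.
  have [le|le] := lerP 0 a.
    rewrite psip_psim psip_vac // raddf0 subr0.
    have -> : (a == a + r.+1%:Z) = false by lia.
    by rewrite andbF scale0r.
  rewrite psim_vac ?raddf0 // ltNge; apply: contra out => h.
  by apply/mapP; exists (absz (- 1 - a)%R); rewrite ?mem_iota; lia.
Qed.

Lemma sum_antisym (V : lmodType C) m (U : nat -> nat -> V) :
  (forall p q, U p q = - U q p) ->
  \sum_(p < m) \sum_(q < m | (p + q < m)%N) U p q = 0.
Proof.
move=> anti; set S := (X in X = _).
have e : S = - S.
  rewrite {1}/S (exchange_big_dep xpredT) //= /S -sumrN; apply: eq_bigr => p _.
  by rewrite -sumrN; apply: eq_big => [q|q _]; [rewrite addnC | exact: anti].
have : 2%:R *: S = 0 by rewrite scaler_nat mulr2n {1}e addNr.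
by move/eqP; rewrite scaler_eq0 pnatr_eq0 /= => /eqP.
Qed.

(* The terms cubic in the fermions cancel, being antisymmetric. *)
Lemma newton_psip j m : m%:R *: psip j (- 1 - m%:Z) (vac R) =
  \sum_(r < m) alpha j r.+1 (psip j (- 1 - (m - r.+1)%N%:Z) (vac R)).
Proof.
under eq_bigr => r _ do rewrite (alpha_psip n0 _ _ _ _ (FinC_vac R n)) // eqxx scale1r.
rewrite big_split /= [X in _ = X + _](_ : _ = 0) ?add0r; last first.
  rewrite -[RHS](@sum_antisym _ m (fun p q =>
     psip j (- 1 - p%:Z) (psip j (- 1 - q%:Z) (psim j (m%:Z - 1 - p%:Z - q%:Z) (vac R))))); last first.
    by move=> p q; rewrite psipC; congr (- psip _ _ (psip _ _ (psim _ _ _))); lia.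
  rewrite (reindex_inj rev_ord_inj) /=; apply: eq_bigr => p _.
  rewrite alpha_vac raddf_sum /=.
  have pm := ltn_ord p.
  have e : ((m - p.+1).+1 <= m)%N by lia.
  rewrite (big_ord_widen m (fun q => psip j (- 1 - (m - (m - p.+1).+1)%N%:Z) (psip j (- 1 - q%:Z) (psim j ((m - p.+1)%N%:Z - q%:Z) (vac R)))) e).
  apply: eq_big => [q|q _]; first by lia.
  have -> : (m - (m - p.+1).+1)%N = p by lia.
  by have -> : (m - p.+1)%N%:Z - q%:Z = m%:Z - 1 - p%:Z - q%:Z by lia.
rewrite (eq_bigr (fun=> psip j (- 1 - m%:Z) (vac R))); last first.
  by move=> r _; have := ltn_ord r; move=> ?; congr (psip _ _ _); lia.
by rewrite sumr_const card_ord scaler_nat.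
Qed.

Lemma newton_psim j m : m%:R *: psim j m%:Z (vac R) =
  - \sum_(r < m) alpha j r.+1 (psim j (m - r.+1)%N%:Z (vac R)).
Proof.
under eq_bigr => r _ do rewrite (alpha_psim n0 _ _ _ _ (FinC_vac R n)) // eqxx scale1r.
rewrite big_split /= [X in _ = - (X + _)](_ : _ = 0) ?add0r; last first.
  rewrite -[RHS](@sum_antisym _ m (fun p q =>
     - psip j (p%:Z + q%:Z - m%:Z) (psim j p%:Z (psim j q%:Z (vac R))))); last first.
    by move=> p q; rewrite [in LHS]psimC linearN /=; congr (- - psip _ _ _); lia.
  rewrite (reindex_inj rev_ord_inj) /=; apply: eq_bigr => p _.
  rewrite alpha_vac (reindex_inj rev_ord_inj) raddf_sum /=.
  have pm := ltn_ord p.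
  have e : ((m - p.+1).+1 <= m)%N by lia.
  rewrite (big_ord_widen m (fun q => psim j (m - (m - p.+1).+1)%N%:Z (psip j (- 1 - ((m - p.+1).+1 - q.+1)%N%:Z) (psim j ((m - p.+1)%N%:Z - ((m - p.+1).+1 - q.+1)%N%:Z) (vac R)))) e).
  apply: eq_big => [q|q hq]; first by lia.
  (* The contracted power of t is nonnegative and the wedged one negative, so no scalar term
     appears. *)
  rewrite psim_psip (_ : (_ == _ :> int) = false); last by lia.
  rewrite andbF scale0r sub0r.
  have -> : (m - (m - p.+1).+1)%N = p by lia.
  have -> : (m - p.+1)%N%:Z - ((m - p.+1).+1 - q.+1)%N%:Z = q%:Z by lia.
  by have -> : - 1 - ((m - p.+1).+1 - q.+1)%N%:Z = p%:Z + q%:Z - m%:Z by lia.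
rewrite (eq_bigr (fun=> - psim j m%:Z (vac R))); last first.
  by move=> r _; have := ltn_ord r; move=> ?; congr (- psim _ _ _); lia.
by rewrite sumr_const card_ord scaler_nat mulNrn opprK.
Qed.

Variables (Q Qi : 'I_n -> Fock R -> Fock R).
Hypothesis HQ : Q_spec Q Qi.

HB.instance Definition _ i := GRing.isLinear.Build C (Fock R) (Fock R) *:%R (Q i) (Q_is_linear HQ i).
HB.instance Definition _ i := GRing.isLinear.Build C (Fock R) (Fock R) *:%R (Qi i) (Qi_is_linear HQ i).

Local Notation Qpow := (Qpow Q Qi).

Lemma QpowS i k f : Q i (Qpow i k f) = Qpow i (k + 1) f.
Proof.
case: k => [p|[|p]]; first by rewrite (_ : Posz p + 1 = Posz p.+1) //; lia.
  by rewrite /= (QiK HQ).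
by rewrite (_ : Negz p.+1 + 1 = Negz p) /= ?(QiK HQ) //; lia.
Qed.

Lemma QpowSr i k f : Qpow i k (Q i f) = Qpow i (k + 1) f.
Proof.
case: k => [p|[|p]]; first by rewrite (_ : Posz p + 1 = Posz p.+1) /= -?iterSr //; lia.
  by rewrite /= (QK HQ).
by rewrite (_ : Negz p.+1 + 1 = Negz p) /Defs.Qpow 1?iterSr ?(QK HQ) //; lia.
Qed.

(** The predicate sees exponent and operator together, so a single induction covers both branches of
    [Qpow] and can track the charge along with the property. *)
Lemma Qpow_ind (Pr : int -> (Fock R -> Fock R) -> Prop) i :
  (forall k T T', T =1 T' -> Pr k T -> Pr k T') ->
  Pr 0 id -> (forall k T, Pr k T -> Pr (k + 1) (Q i \o T)) ->
  (forall k T, Pr k T -> Pr (k - 1) (Qi i \o T)) -> forall k, Pr k (Qpow i k).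
Proof.
move=> ext h0 hp hm k; elim/int_ind: k => [|p IH|p IH]; first exact: ext h0.
  by have := hp _ _ IH; rewrite -PoszD addn1; apply: ext.
have -> : - p.+1%:Z = - p%:Z - 1 by lia.
apply: ext (hm _ _ IH) => f /=; apply: (can_inj (QK HQ i)).
by rewrite (QiK HQ) QpowS subrK.
Qed.

Lemma Qpow_is_linear i k : linear (Qpow i k).
Proof.
apply: (Qpow_ind (Pr := fun _ T => linear T)) => [_ T T' e h c f g|c f g|{}k T h c f g|{}k T h c f g].
- by rewrite -!e h.
- by [].
- by rewrite /= h linearP.
- by rewrite /= h linearP.
Qed.
HB.instance Definition _ i k := GRing.isLinear.Build C (Fock R) (Fock R) *:%R (Qpow i k) (Qpow_is_linear i k).

Lemma FinC_Qpow c i k f : FinC n c f -> FinC n (c + k) (Qpow i k f).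
Proof.
move=> hf; apply: (Qpow_ind (Pr := fun k T => FinC n (c + k) (T f))) => [k' T T' e|//|{}k T|{}k T].
- by rewrite e.
- by rewrite addr0.
- by move=> h; rewrite /= addrA; apply: (FinC_Q n0 HQ).
- by move=> h; rewrite /= addrA; apply: (FinC_Qi n0 HQ).
Qed.

(** Only membership in a span is at stake, so the sign is left existential. *)
Lemma Qpow_psip i k j : exists u : C, forall a f,
  psip j a (Qpow i k f) = u *: Qpow i k (psip j (a + (i == j)%:Z * k) f).
Proof.
apply: (Qpow_ind (Pr := fun k T => exists u : C, forall a f,
  psip j a (T f) = u *: T (psip j (a + (i == j)%:Z * k) f))) => [k' T T' e [u h]||{}k T [u h]|{}k T [u h]].
- by exists u => a f; rewrite -!e.
- by exists 1 => a f; rewrite mulr0 addr0 scale1r.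
- exists (csg R i j * u) => a f /=.
  have := Q_psip HQ i j (a + (i == j)%:Z) (T f); rewrite addrK => e.
  move/(congr1 (fun v => csg R i j *: v)): e; rewrite scalerA csgK scale1r => <-.
  rewrite h linearZ /= scalerA.
  by congr (_ *: Q i (T (psip _ _ _))); ring.
- exists (csg R i j * u) => a f /=.
  have := Qi_psip HQ i j (a - (i == j)%:Z) (T f); rewrite subrK => e.
  move/(congr1 (fun v => csg R i j *: v)): e; rewrite scalerA csgK scale1r => <-.
  rewrite h linearZ /= scalerA.
  by congr (_ *: Qi i (T (psip _ _ _))); ring.
Qed.

Lemma Qpow_psim i k j : exists u : C, forall a f,
  psim j a (Qpow i k f) = u *: Qpow i k (psim j (a + (i == j)%:Z * k) f).
Proof.
apply: (Qpow_ind (Pr := fun k T => exists u : C, forall a f,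
  psim j a (T f) = u *: T (psim j (a + (i == j)%:Z * k) f))) => [k' T T' e [u h]||{}k T [u h]|{}k T [u h]].
- by exists u => a f; rewrite -!e.
- by exists 1 => a f; rewrite mulr0 addr0 scale1r.
- exists (csg R i j * u) => a f /=.
  have := Q_psim HQ i j (a + (i == j)%:Z) (T f); rewrite addrK => e.
  move/(congr1 (fun v => csg R i j *: v)): e; rewrite scalerA csgK scale1r => <-.
  rewrite h linearZ /= scalerA.
  by congr (_ *: Q i (T (psim _ _ _))); ring.
- exists (csg R i j * u) => a f /=.
  have := Qi_psim HQ i j (a - (i == j)%:Z) (T f); rewrite subrK => e.
  move/(congr1 (fun v => csg R i j *: v)): e; rewrite scalerA csgK scale1r => <-.
  rewrite h linearZ /= scalerA.
  by congr (_ *: Qi i (T (psim _ _ _))); ring.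
Qed.

Lemma Qpow_alpha c i k j m f : (0 < m)%N -> FinC n c f ->
  Qpow i k (alpha j m f) = alpha j m (Qpow i k f).
Proof.
move=> m0 hf; suff [] : FinC n (c + k) (Qpow i k f) /\
  Qpow i k (alpha j m f) = alpha j m (Qpow i k f) by [].
apply: (Qpow_ind (Pr := fun k T => FinC n (c + k) (T f) /\ T (alpha j m f) = alpha j m (T f))) => [k' T T' e [h h']||{}k T [h h']|{}k T [h h']].
- by rewrite -!e.
- by rewrite addr0.
- by rewrite /= h' (Q_alpha n0 HQ _ _ m0 h) addrA; split=> //; apply: (FinC_Q n0 HQ).
- by rewrite /= h' (Qi_alpha n0 HQ _ _ m0 h) addrA; split=> //; apply: (FinC_Qi n0 HQ).
Qed.

(** Here the scalar must be nonzero, because it is inverted when Q_j is moved into its place in a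
    word. *)
Lemma Qpow_Q c i k j f : FinC n c f ->
  exists2 u : C, u != 0 & Qpow i k (Q j f) = u *: Q j (Qpow i k f).
Proof.
move=> hf; have [<-|ne] := eqVneq i j.
  by exists 1; rewrite ?oner_eq0 // scale1r QpowS QpowSr.
suff [] : FinC n (c + k) (Qpow i k f) /\
  exists2 u : C, u != 0 & Qpow i k (Q j f) = u *: Q j (Qpow i k f) by [].
apply: (Qpow_ind (Pr := fun k T => FinC n (c + k) (T f) /\
  exists2 u : C, u != 0 & T (Q j f) = u *: Q j (T f))) => [k' T T' e [h h']||{}k T [h [u u0 h']]|{}k T [h [u u0 h']]].
- by rewrite -!e.
- by rewrite addr0; split=> //; exists 1; rewrite ?oner_eq0 // scale1r.
- rewrite addrA; split; first exact: (FinC_Q n0 HQ).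
  by exists (- u); rewrite ?oppr_eq0 //= h' linearZ /= (QQ HQ ne h) scalerN scaleNr.
- rewrite addrA; split; first exact: (FinC_Qi n0 HQ).
  by exists (- u); rewrite ?oppr_eq0 //= h' linearZ /= (QiQ n0 HQ ne h) scalerN scaleNr.
Qed.

Definition QW (s : seq 'I_n) (k : 'I_n -> int) f := foldr (fun i acc => Qpow i (k i) acc) f s.

Lemma QwordE k f : Qword Q Qi k f = QW (enum 'I_n) k f. Proof. by []. Qed.

Lemma QW_is_linear s k : linear (QW s k).
Proof. by move=> c f g; elim: s => //= i s ->; rewrite linearP. Qed.
HB.instance Definition _ s k := GRing.isLinear.Build C (Fock R) (Fock R) *:%R (QW s k) (QW_is_linear s k).

Lemma FinC_QW c s k f : FinC n c f -> FinC n (c + \sum_(i <- s) k i) (QW s k f).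
Proof.
move=> hf; elim: s => [|i s IH]; first by rewrite big_nil addr0.
by rewrite big_cons addrA addrAC; apply: FinC_Qpow.
Qed.

Lemma QW_psip s k j : exists (u : C) b, forall a f,
  psip j a (QW s k f) = u *: QW s k (psip j (a + b) f).
Proof.
elim: s => [|i s [u [b IH]]]; first by exists 1, 0 => a f; rewrite addr0 scale1r.
have [v h] := Qpow_psip i (k i) j.
exists (v * u), ((i == j)%:Z * k i + b) => a f /=.
by rewrite h IH linearZ /= scalerA addrA.
Qed.

Lemma QW_psim s k j : exists (u : C) b, forall a f,
  psim j a (QW s k f) = u *: QW s k (psim j (a + b) f).
Proof.
elim: s => [|i s [u [b IH]]]; first by exists 1, 0 => a f; rewrite addr0 scale1r.
have [v h] := Qpow_psim i (k i) j.
exists (v * u), ((i == j)%:Z * k i + b) => a f /=.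
by rewrite h IH linearZ /= scalerA addrA.
Qed.

Lemma QW_alpha c s k j m f : (0 < m)%N -> FinC n c f ->
  QW s k (alpha j m f) = alpha j m (QW s k f).
Proof.
by move=> m0 hf; elim: s => //= i s ->; rewrite (Qpow_alpha _ _ _ m0 (FinC_QW s k hf)).
Qed.

Lemma QW_Q c s k j f : FinC n c f ->
  exists2 u : C, u != 0 & QW s k (Q j f) = u *: Q j (QW s k f).
Proof.
move=> hf; elim: s => [|i s [u u0 IH]]; first by exists 1; rewrite ?oner_eq0 // scale1r.
have [v v0 h] := Qpow_Q i (k i) j (FinC_QW s k hf).
by exists (u * v); rewrite ?mulf_neq0 //= IH linearZ /= h scalerA.
Qed.

Lemma eq_QW s k k' f : {in s, k =1 k'} -> QW s k f = QW s k' f.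
Proof.
elim: s => //= i s IH e; rewrite e ?mem_head // IH // => x xs.
by rewrite e // in_cons xs orbT.
Qed.

Lemma Q_QW c s k j f : FinC n c f -> uniq s -> j \in s ->
  exists2 u : C, u != 0 & Q j (QW s k f) = u *: QW s (fun i => k i + (i == j)%:Z) f.
Proof.
move=> hf; elim: s => //= i s IH /andP[nis us]; rewrite in_cons.
have [ji _|ne /= js] := eqVneq j i.
  subst i; exists 1; rewrite ?oner_eq0 // QpowS scale1r; congr (Qpow _ _ _).
  apply: eq_QW => x xs; have -> : (x == j) = false by apply: contraNF nis => /eqP <-.
  by rewrite addr0.
have [u u0 h] := IH us js; have [v v0 h'] := Qpow_Q i (k i) j (FinC_QW s k hf).
exists (v^-1 * u); rewrite ?mulf_neq0 ?invr_eq0 //.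
have := congr1 (Qpow i (k i)) h; rewrite h' linearZ /= => e.
by rewrite addr0 -scalerA -e scalerA mulVf // scale1r.
Qed.

Lemma Qi_QW c s k j f : FinC n c f -> uniq s -> j \in s ->
  exists2 u : C, u != 0 & Qi j (QW s k f) = u *: QW s (fun i => k i - (i == j)%:Z) f.
Proof.
move=> hf us js; have [u u0 h] := Q_QW (fun i => k i - (i == j)%:Z) hf us js.
exists u^-1; rewrite ?invr_eq0 //; apply: (can_inj (QK HQ j)).
rewrite linearZ /= h scalerA mulVf // scale1r (QiK HQ).
by apply: eq_QW => x _; rewrite subrK.
Qed.

(** * Each charged piece of the Fock space is spanned by words in the alpha's and Q's *)

Definition word (ws : seq ('I_n * nat)) (k : Mlat n) :=
  foldr (fun p v => alpha p.1 p.2 v) (Qword Q Qi k (vac R)) ws.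

(** The span of words of any charge: sigma is known only in charge 0, but applying one fermion at a
    time leaves charge 0. *)
Inductive AspC (c : int) : Fock R -> Prop :=
| Asp_word ws (k : Mlat n) : all (fun p => (0 < p.2)%N) ws -> \sum_(i < n) k i = c ->
    AspC c (word ws k)
| Asp_lin (u : C) f g : AspC c f -> AspC c g -> AspC c (u *: f + g).

Lemma AspC_zero c : AspC c 0.
Proof.
set f := word [::] [ffun i => if i == Ordinal n0 then c else 0].
rewrite -[0](addNr f) -scaleN1r; apply: Asp_lin; apply: Asp_word => //.
all: rewrite (bigD1 (Ordinal n0)) //= big1 ?ffunE ?eqxx ?addr0 // => i.
all: by rewrite ffunE => /negbTE ->.
Qed.

Lemma AspCZ c u f : AspC c f -> AspC c (u *: f).
Proof. by move=> h; rewrite -[_ *: _]addr0; apply/Asp_lin => //; apply: AspC_zero. Qed.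

Lemma AspC_sum c (T : Type) (r : seq T) (F : T -> Fock R) :
  (forall x, AspC c (F x)) -> AspC c (\sum_(x <- r) F x).
Proof.
move=> hF; elim: r => [|x r IH]; rewrite ?big_nil ?big_cons; first exact: AspC_zero.
by rewrite -[F x]scale1r; apply: Asp_lin.
Qed.

Lemma AspC_alpha c j m f : (0 < m)%N -> AspC c f -> AspC c (alpha j m f).
Proof.
move=> m0; elim=> {f} [ws k h e|u f g _ IHf _ IHg]; last by rewrite linearP; apply: Asp_lin.
by apply: (@Asp_word c ((j, m) :: ws) k); rewrite /= ?m0.
Qed.

Lemma FinC_Qword k : FinC n (\sum_(i < n) k i) (Qword Q Qi k (vac R)).
Proof.
by have := FinC_QW (enum 'I_n) k (FinC_vac R n); rewrite add0r big_enum.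
Qed.

Lemma FinC_word ws (k : Mlat n) : all (fun p => (0 < p.2)%N) ws ->
  FinC n (\sum_(i < n) k i) (word ws k).
Proof.
elim: ws => [_|p ws IH] /=; first exact: FinC_Qword.
by move=> /andP[p0 /IH]; apply: FinC_alpha.
Qed.

Lemma AspC_Qword_psip (k : Mlat n) j b :
  AspC (\sum_(i < n) k i + 1) (Qword Q Qi k (psip j b (vac R))).
Proof.
rewrite QwordE; have [b0|b0] := lerP 0 b.
  by rewrite psip_vac // raddf0; apply: AspC_zero.
have -> : b = - 1 - (absz (- 1 - b)%R)%:Z by lia.
(* The lowest mode on the vacuum is Q_j itself; higher modes reduce to lower ones by
   [newton_psip]. *)
move: (absz _) => m {b b0}; elim/ltn_ind: m => -[_|m IH].
  rewrite subr0 -(Q_vac HQ).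
  have [u u0 ->] := QW_Q (enum 'I_n) k j (FinC_vac R n).
  have [v v0 ->] := Q_QW k (FinC_vac R n) (enum_uniq 'I_n) (mem_enum 'I_n j).
  apply/AspCZ/AspCZ; rewrite -QwordE.
  have -> : Qword Q Qi (fun i => k i + (i == j)%:Z) (vac R) =
      word [::] [ffun i => k i + (i == j)%:Z].
    by apply: eq_QW => x _; rewrite ffunE.
  apply: Asp_word => //; under eq_bigr => i _ do rewrite ffunE.
  rewrite big_split /=; congr (_ + _).
  by rewrite (bigD1 j) //= eqxx big1 ?addr0 // => i /negbTE ->.
have m1 : m.+1%:R != 0 :> C by rewrite pnatr_eq0.
rewrite -[psip j _ _]scale1r -(mulVf m1) -scalerA newton_psip linearZ /=.
apply: AspCZ; rewrite raddf_sum; apply: AspC_sum => r /=.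
rewrite (QW_alpha _ _ _ _ (FinC_psip _ _ (FinC_vac R n))) //.
by apply: AspC_alpha => //; apply: IH; have := ltn_ord r; lia.
Qed.

Lemma AspC_Qword_psim (k : Mlat n) j b :
  AspC (\sum_(i < n) k i - 1) (Qword Q Qi k (psim j b (vac R))).
Proof.
rewrite QwordE; have [b0|b0] := ltrP b 0.
  by rewrite psim_vac // raddf0; apply: AspC_zero.
have -> : b = (absz b)%:Z by lia.
move: (absz _) => m {b b0}; elim/ltn_ind: m => -[_|m IH].
  set k' := [ffun i => k i - (i == j)%:Z] : Mlat n.
  have [u u0 e] := QW_Q (enum 'I_n) k j (FinC_Qi n0 HQ j (FinC_vac R n)).
  have [v v0 e'] := Q_QW k' (FinC_vac R n) (enum_uniq 'I_n) (mem_enum 'I_n j).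
  (* Mode 0 on the vacuum is Q_j^-1, which lowers the exponent of Q_j by one up to a nonzero
     scalar. *)
  have -> : QW (enum 'I_n) k (psim j 0 (vac R)) = (u^-1 * v^-1) *: word [::] k'.
    rewrite -(Qi_vac HQ); apply: (can_inj (QK HQ j)).
    rewrite linearZ /= QwordE e' scalerA -mulrA mulVf // mulr1.
    rewrite (eq_QW (k' := k)); last by move=> x _; rewrite ffunE subrK.
    by rewrite -[in RHS](QiK HQ j (vac R)) e scalerA mulVf // scale1r.
  apply/AspCZ/Asp_word => //; under eq_bigr => i _ do rewrite ffunE.
  rewrite big_split /= sumrN; congr (_ - _).
  by rewrite (bigD1 j) //= eqxx big1 ?addr0 // => i /negbTE ->.
have m1 : m.+1%:R != 0 :> C by rewrite pnatr_eq0.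
rewrite -[psim j _ _]scale1r -(mulVf m1) -scalerA newton_psim linearZ /=.
apply: AspCZ; rewrite raddfN raddf_sum -scaleN1r; apply/AspCZ/AspC_sum => r /=.
rewrite (QW_alpha _ _ _ _ (FinC_psim _ _ (FinC_vac R n))) //.
by apply: AspC_alpha => //; apply: IH; have := ltn_ord r; lia.
Qed.

(** The fermion moves inward through the alpha's; every commutator term is again a fermion on a
    shorter word. *)
Lemma AspC_psip c j a f : AspC c f -> AspC (c + 1) (psip j a f).
Proof.
elim=> {f} [ws k h <-|u f g _ hf _ hg]; last by rewrite linearP; apply: Asp_lin.
elim: ws h a => [_ a|[i m] ws IH /andP[/= m0 hws] a].
  have [u [b e]] := QW_psip (enum 'I_n) k j.
  by rewrite /word /= QwordE e; apply/AspCZ/AspC_Qword_psip.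
have := alpha_psip n0 i j a m0 (FinC_word k hws).
move=> /esym/(canRL (addrK _)) e; rewrite /word /= -/(word _ _) e [X in AspC _ X]addrC -scaleNr.
apply: Asp_lin; first exact: IH.
by apply: AspC_alpha => //; apply: IH.
Qed.

Lemma AspC_psim c j a f : AspC c f -> AspC (c - 1) (psim j a f).
Proof.
elim=> {f} [ws k h <-|u f g _ hf _ hg]; last by rewrite linearP; apply: Asp_lin.
elim: ws h a => [_ a|[i m] ws IH /andP[/= m0 hws] a].
  have [u [b e]] := QW_psim (enum 'I_n) k j.
  by rewrite /word /= QwordE e; apply/AspCZ/AspC_Qword_psim.
have := alpha_psim n0 i j a m0 (FinC_word k hws).
move=> /esym/(canRL (subrK _)) e; rewrite /word /= -/(word _ _) e [X in AspC _ X]addrC; apply: Asp_lin; first exact: IH.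
by apply: AspC_alpha => //; apply: IH.
Qed.

Lemma QW0 s f : QW s (fun=> 0) f = f.
Proof. by elim: s. Qed.

Lemma FinC_AspC c f : FinC n c f -> AspC c f.
Proof.
elim=> {c f} [|c j a f _|c j a f _|c k f g _ hf _ hg].
- have -> : vac R = word [::] (M0 n).
    by rewrite -[LHS](QW0 (enum 'I_n)); apply: eq_QW => x _; rewrite ffunE.
  by apply: Asp_word => //; rewrite big1 // => i; rewrite ffunE.
- exact: AspC_psip.
- exact: AspC_psim.
- exact: Asp_lin.
Qed.

(** * Coefficients of sigma at a point, and the vertex operator relation *)

Implicit Types (y : Xvar R n) (k : Mlat n) (l : 'I_n).
Variable sigma : Fock R -> Target R n.
Hypothesis Hsigma : bf_spec Q Qi sigma.

Definition tauF k y f : C := sigma f k y.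
Local Notation E := (tauF (M0 n)).

Lemma tau_is_linear k y : linear_for *%R (tauF k y).
Proof. by move=> c f g; rewrite /tauF; have [h _] := Hsigma; rewrite h. Qed.
HB.instance Definition _ k y := GRing.isLinear.Build C (Fock R) C *%R (tauF k y) (tau_is_linear k y).

Lemma tau_word k y ws k' : all (fun p => (0 < p.2)%N) ws -> \sum_(i < n) k' i = 0 ->
  tauF k y (word ws k') = (k == k')%:R * (\prod_(p <- ws) (p.2)%:R * \prod_(p <- ws) y p.1 p.2).
Proof.
move=> h s0; have [_ H] := Hsigma; rewrite /tauF [sigma _](H ws k' h s0).
by case: eqP => _; rewrite ?mul1r ?mul0r.
Qed.

Lemma E_alpha y j m f : (0 < m)%N -> AspC 0 f -> E y (alpha j m f) = m%:R * y j m * E y f.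
Proof.
move=> m0; elim=> {f} [ws k h s0|u f g _ IHf _ IHg].
  rewrite -[alpha j m _]/(word ((j, m) :: ws) k) !tau_word //= ?m0 //.
  by rewrite !big_cons /=; ring.
by rewrite !linearP /= IHf IHg; ring.
Qed.

Lemma FinC_Qi_psip c i j a f : FinC n c f -> FinC n c (Qi i (psip j a f)).
Proof. by move=> hf; rewrite -[c](addrK 1); apply/(FinC_Qi n0 HQ)/FinC_psip. Qed.

Lemma E_FinC_alpha y j m f : (0 < m)%N -> FinC n 0 f ->
  E y (alpha j m f) = m%:R * y j m * E y f.
Proof. by move=> m0 /FinC_AspC; apply: E_alpha. Qed.

Lemma E_vac y : E y (vac R) = 1.
Proof.
rewrite -[vac R](QW0 (enum 'I_n)).
rewrite -(eq_QW (k := M0 n)); last by move=> x _; rewrite ffunE.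
rewrite -[QW _ _ _]/(word [::] (M0 n)) tau_word //; last by rewrite big1 // => i; rewrite ffunE.
by rewrite eqxx !big_nil !mulr1.
Qed.

(** Newton's identity for the one-fermion state, with each alpha_(-r) replaced by r y_r, is exactly
    the recursion [hseqS]. *)
Lemma E_QW_psip y k j m : \sum_(i < n) k i = 0 ->
  E y (Qi j (QW (enum 'I_n) k (psip j (- 1 - m%:Z) (vac R)))) = (M0 n == k)%:R * hseq (y j) m.
Proof.
move=> k0; have fin c f : FinC n c f -> FinC n c (QW (enum 'I_n) k f).
  by move=> hf; have := FinC_QW (enum 'I_n) k hf; rewrite big_enum k0 addr0.
elim/ltn_ind: m => -[_|m IH].
  rewrite subr0 -(Q_vac HQ) hseq0 mulr1; have [e|ne] := eqVneq (M0 n) k.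
    rewrite (eq_QW (k' := fun=> 0)); last by move=> x _; rewrite -e ffunE.
    by rewrite QW0 (QK HQ) E_vac.
  have [u _ ->] := QW_Q (enum 'I_n) k j (FinC_vac R n).
  rewrite linearZ /= (QK HQ) linearZ /= -[QW _ _ _]/(word [::] k) tau_word //.
  by rewrite (negbTE ne) mul0r mulr0.
have m1 : m.+1%:R != 0 :> C by rewrite pnatr_eq0.
apply: (mulfI m1); rewrite mulrCA hseqS mulr_sumr.
transitivity (E y (Qi j (QW (enum 'I_n) k (m.+1%:R *: psip j (- 1 - m.+1%:Z) (vac R))))).
  by rewrite !linearZ.
rewrite newton_psip // !raddf_sum; apply: eq_bigr => r _ /=.
have hv := FinC_psip j (- 1 - (m.+1 - r.+1)%N%:Z) (FinC_vac R n).
rewrite (QW_alpha _ _ _ _ hv) // (Qi_alpha n0 HQ _ _ _ (fin _ _ hv)) //.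
rewrite E_FinC_alpha //; last first.
  by have := FinC_Qi n0 HQ j (fin _ _ hv); rewrite addrK.
by rewrite IH; [rewrite subSS mulrCA | have := ltn_ord r; lia].
Qed.

Lemma E_QW_psip_any y k j a : \sum_(i < n) k i = 0 ->
  E y (Qi j (QW (enum 'I_n) k (psip j a (vac R)))) =
    (M0 n == k)%:R * (if a < 0 then hseq (y j) (absz (- 1 - a)%R) else 0).
Proof.
move=> k0; case: ltrP => ha; last by rewrite psip_vac // !raddf0 mulr0.
by rewrite -E_QW_psip //; congr (E y (Qi j (QW _ _ (psip _ _ _)))); lia.
Qed.

(* For a vertex operator [Q_j^-1 psi^+(exp(-x^(j)) e_j t^(-1-k))] and [k >= 0], only the
   leading term survives; it suffices to commute the alpha's through. *)
Lemma E_vertex_Asp y j f : AspC 0 f -> exists K, forall k M : nat, (K + k <= M)%N ->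
  \sum_(r < M) hseq (fun m => - y j m) r * E y (Qi j (psip j (r%:Z - 1 - k%:Z) f)) =
  (k == 0)%:R * E y f.
Proof.
elim=> {f} [ws k h s0|u f g _ [K hK] _ [K' hK']]; last first.
  exists (maxn K K') => k M le.
  rewrite linearP /= mulrDr mulrCA -(hK k M) -?(hK' k M); try lia.
  rewrite mulr_sumr -big_split; apply: eq_bigr => r _ /=.
  by rewrite !linearP /=; ring.
elim: ws h => [_|[i m] ws IH /andP[/= m0 hws]].
  exists 1%N => k' M le; rewrite /word /= QwordE.
  have [e|ne] := eqVneq (M0 n) k.
    have QWk f : QW (enum 'I_n) k f = f.
      by rewrite (eq_QW (k' := fun=> 0)) ?QW0 // => x _; rewrite -e ffunE.
    (* On the vacuum the sum is the coefficient of t^k in exp(-Y) exp(Y), where Y is the sum of the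
       y_m t^m in colour j. *)
    rewrite QWk E_vac mulr1 -[RHS]/(@conv1 C k') -(hseq_inv (y j)).
    rewrite /conv (big_ord_widen M (fun r => hseq (fun m => - y j m) r * hseq (y j) (k' - r)%N)); last by lia.
    rewrite [RHS]big_mkcond; apply: eq_bigr => r _.
    rewrite -[psip j _ _]QWk E_QW_psip_any // e eqxx mul1r.
    case: ltrP => hr; case: ifP => hr'; try lia; last by rewrite mulr0.
    by congr (_ * hseq _ _); lia.
  rewrite -[QW _ _ _]/(word [::] k) tau_word // (negbTE ne) mul0r mulr0 big1 // => r _.
  have [u [b e]] := QW_psip (enum 'I_n) k j.
  rewrite /word /= QwordE e !linearZ /= E_QW_psip_any // (negbTE ne) mul0r.
  by rewrite !mulr0.
have [K hK] := IH hws; exists (K + m)%N => k' M le.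
have fw : FinC n 0 (word ws k) by rewrite -s0; apply: FinC_word.
rewrite E_FinC_alpha //.
(* Commuting the current to the left lowers the power of t by m in the extra term. That term is the
   same relation with k + m > 0 for a shorter word, hence 0; this is why all k are treated
   together. *)
transitivity (m%:R * y i m * \sum_(r < M) hseq (fun m => - y j m) r * E y (Qi j (psip j (r%:Z - 1 - k'%:Z) (word ws k)))
  - (i == j)%:R * \sum_(r < M) hseq (fun m => - y j m) r * E y (Qi j (psip j (r%:Z - 1 - (k' + m)%N%:Z) (word ws k)))).
  rewrite !mulr_sumr -sumrB; apply: eq_bigr => r _.
  have := alpha_psip n0 i j (r%:Z - 1 - k'%:Z) m0 fw.
  move=> /esym/(canRL (addrK _)) ->.
  rewrite linearB /= (Qi_alpha n0 HQ _ _ m0 (FinC_psip _ _ fw)) linearB /= E_FinC_alpha //; last exact: FinC_Qi_psip.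
  rewrite [Qi j (_ *: _)]linearZ [E y (_ *: _)]linearZ /= (_ : r%:Z - 1 - k'%:Z - m%:Z = r%:Z - 1 - (k' + m)%N%:Z); last by lia.
  by ring.
rewrite hK; last by lia.
rewrite hK; last by lia.
rewrite (_ : (k' + m == 0)%N = false) /=; last by lia.
by ring.
Qed.

(** The cutoff from [E_vertex_Asp] depends on an expansion into words and may depend on y. Extending
    the sum and dropping modes that kill f gives a cutoff depending on f alone. *)
Lemma E_vertex y j f K (k M : nat) : FinC n 0 f -> bnd n K f -> (K + k < M)%N ->
  \sum_(r < M) hseq (fun m => - y j m) r * E y (Qi j (psip j (r%:Z - 1 - k%:Z) f)) =
  (k == 0)%:R * E y f.
Proof.
move=> ff hK le; have [K' h] := E_vertex_Asp y j (FinC_AspC ff).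
rewrite -(h k (M + (K' + k))%N) ?leq_addl //.
rewrite big_split_ord /= [X in _ = _ + X]big1 ?addr0 // => r _.
have [h' _] := hK j ((M + r)%N%:Z - 1 - k%:Z).
by rewrite h' ?raddf0 ?mulr0 //; lia.
Qed.

(* [Gf i y f M l a] is the expectation of [Q_i^-1 psi^+(exp(-x) e_l t^a)], truncated at order [M]. *)
Definition Gf i y f (M : nat) l a : C :=
  \sum_(r < M) hseq (fun m => - y l m) r * E y (Qi i (psip l (a + r%:Z) f)).

Lemma Gf_same i y f K M (p : nat) : FinC n 0 f -> bnd n K f -> (K + p < M)%N ->
  Gf i y f M i (- 1 - p%:Z) = (p == 0)%:R * E y f.
Proof.
move=> ff hK le; rewrite -(E_vertex y i ff hK le); apply: eq_bigr => r _.
by congr (_ * E y (Qi i (psip _ _ _))); lia.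
Qed.

Lemma FinC_QQi i l f : FinC n 0 f -> FinC n 0 (Q l (Qi i f)).
Proof. by move=> ff; have := FinC_Q n0 HQ l (FinC_Qi n0 HQ i ff). Qed.

(** Up to sign, Q_i^-1 psi_l f equals Q_l^-1 psi_l applied to Q_l Q_i^-1 f with the power of t
    lowered by one. So this is the vertex relation in colour l, with its critical power moved from
    t^-1 to t^0. *)
Lemma Gf_diff i y f K M l (p : nat) : l != i -> FinC n 0 f -> bnd n K (Q l (Qi i f)) ->
  (K + p < M)%N ->
  Gf i y f M l (- p%:Z) = - ((p == 0)%:R * E y (Q l (Qi i f))).
Proof.
move=> ne ff hK le; have fg := FinC_QQi i l ff.
rewrite -(E_vertex y l fg hK le) -sumrN; apply: eq_bigr => r _; rewrite -mulrN; congr (_ * _).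
rewrite -raddfN; congr (E y _); rewrite (Qi_psip HQ) /csg eq_sym (negbTE ne) addr0 scaleN1r.
congr (- _); apply: (can_inj (QK HQ l)); rewrite (QiK HQ) (Q_psip HQ) /csg eqxx scale1r.
by congr (psip _ _ _); lia.
Qed.

(** The operator whose index comes first in s stands outermost; this order is the source of the sign
    epsilon. *)
Lemma QW_delta i j s : i != j -> uniq s ->
  QW s (Msub (delta i) (delta j)) (vac R) =
    if i \in s then
      if j \in s then
        if (index i s < index j s)%N then Q i (Qi j (vac R)) else Qi j (Q i (vac R))
      else Q i (vac R)
    else if j \in s then Qi j (vac R) else vac R.
Proof.
move=> ne; elim: s => //= x s IH /andP[xs us]; rewrite IH // !in_cons !ffunE.
rewrite (eq_sym i x) (eq_sym j x).
have [xi|xi] := eqVneq x i; have [xj|xj] := eqVneq x j => /=.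
- by move: ne; rewrite -xi -xj eqxx.
- by rewrite -xi (negbTE xs); case: ifP.
- by rewrite -xj (negbTE xs); case: ifP.
- by rewrite ltnS; do !case: ifP.
Qed.

Definition walpha (ws : seq ('I_n * nat)) f := foldr (fun p v => alpha p.1 p.2 v) f ws.

Lemma tau_delta y i j f : i != j -> FinC n 0 f ->
  @epsM R n j i * tauF (Msub (delta i) (delta j)) y f = - E y (Q j (Qi i f)).
Proof.
move=> ne /FinC_AspC; elim=> {f} [ws k h s0|u f g _ IHf _ IHg]; last first.
  by rewrite !linearP /= mulrDr mulrCA IHf IHg.
have QjQi ws' f : all (fun p => (0 < p.2)%N) ws' -> FinC n 0 f ->
    Q j (Qi i (walpha ws' f)) =
    walpha ws' (Q j (Qi i f)).
  move=> hws hf; suff [] : FinC n 0 (walpha ws' f) /\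
    Q j (Qi i (walpha ws' f)) =
    walpha ws' (Q j (Qi i f)) by [].
  elim: ws' hws => //= p ws' IH /andP[p0 /IH [IH1 IH2]]; split; first exact: (FinC_alpha n0 _ p0 IH1).
  rewrite (Qi_alpha n0 HQ _ _ p0 IH1) (Q_alpha n0 HQ _ _ p0 (FinC_Qi n0 HQ i IH1)).
  by rewrite IH2.
have fk : FinC n 0 (Qword Q Qi k (vac R)) by rewrite -s0; apply: FinC_Qword.
rewrite -{2}[word ws k]/(walpha ws (Qword Q Qi k (vac R))) QjQi // tau_word //.
have [e|nek] := eqVneq (Msub (delta i) (delta j)) k; last first.
  (* For any other lattice exponent, Q_j Q_i^-1 leaves a nonzero exponent, so both sides vanish. *)
  have [u u0 e1] := Qi_QW k (FinC_vac R n) (enum_uniq 'I_n) (mem_enum 'I_n i).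
  have [v v0 e2] := Q_QW (fun l => k l - (l == i)%:Z) (FinC_vac R n) (enum_uniq 'I_n) (mem_enum 'I_n j).
  rewrite QwordE e1 linearZ /= e2 scalerA.
  set k' : Mlat n := [ffun l => k l - (l == i)%:Z + (l == j)%:Z].
  rewrite (eq_QW (k' := k')); last by move=> l _; rewrite ffunE.
  have fZ (w : C) g : walpha ws (w *: g) =
      w *: walpha ws g.
    by elim: (ws) => //= p ws' ->; rewrite linearZ.
  rewrite fZ linearZ /= -[walpha _ _]/(word ws k') tau_word //; last first.
    under eq_bigr => l _ do rewrite ffunE.
    rewrite big_split sumrB /= s0.
    have one l0 : \sum_(l < n) (l == l0)%:Z = 1.
      by rewrite (bigD1 l0) //= eqxx big1 ?addr0 // => l /negbTE ->.
    by rewrite !one.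
  have -> : (M0 n == k') = false.
    apply: contraNF nek => /eqP/ffunP e; apply/eqP/ffunP => l.
    by have := e l; rewrite !ffunE; move: (k l) => z; case: (l == i); case: (l == j) => /= ez; lia.
  by rewrite !mul0r !mulr0 oppr0.
rewrite mul1r QwordE -e QW_delta ?enum_uniq // !mem_enum /= !index_enum_ord /epsM.
have wk0 : walpha ws (vac R) = word ws (M0 n).
  rewrite /word -/(walpha _ _); congr walpha; rewrite QwordE -[LHS](QW0 (enum 'I_n)).
  by apply: eq_QW => x _; rewrite ffunE.
have M00 : \sum_(l < n) M0 n l = 0 by rewrite big1 // => l; rewrite ffunE.
case: ltnP => ij.
  by rewrite (QK HQ) (QiK HQ) wk0 tau_word // eqxx !mul1r mulN1r.
rewrite (QiQi n0 HQ _ (FinC_Q n0 HQ i (FinC_vac R n))) // (QK HQ) raddfN /= (QiK HQ).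
have fN g : walpha ws (- g) =
      - walpha ws g.
  by elim: (ws) => //= p ws' ->; rewrite raddfN.
by rewrite fN raddfN /= wk0 tau_word // eqxx !mul1r opprK.
Qed.

Lemma E_Qi_sum y i (T : Type) (r : seq T) (c : T -> C) (F : T -> Fock R) :
  E y (Qi i (\sum_(x <- r) c x *: F x)) = \sum_(x <- r) c x * E y (Qi i (F x)).
Proof.
by rewrite !raddf_sum; apply: eq_bigr => x _ /=; rewrite !linearZ.
Qed.

Lemma E_pder y l f : FinC n 0 f -> exists e : C, is_pder (fun h => E (upd y l h) f) e.
Proof.
move=> /FinC_AspC; elim=> {f} [ws k h s0|u f g _ [d hd] _ [d' hd']]; last first.
  exists (u * d + d'); rewrite (_ : (fun h => _) = fun h => u * E (upd y l h) f + E (upd y l h) g).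
    exact/is_pderD/hd'/is_pderZ.
  by apply/funext => h; rewrite linearP.
rewrite (_ : (fun h => _) = fun h => ((M0 n == k)%:R * \prod_(p <- ws) (p.2)%:R) *
    \prod_(p <- ws) upd y l h p.1 p.2); last first.
  by apply/funext => h'; rewrite tau_word // mulrA.
suff [d hd] : exists e : C, is_pder (fun h => \prod_(p <- ws) upd y l h p.1 p.2) e.
  by eexists; apply/is_pderZ/hd.
elim: (ws) => [|p ws' [d hd]].
  exists 0; rewrite (_ : (fun h => _) = fun=> 1); first exact: is_pder_cst.
  by apply/funext => h'; rewrite big_nil.
rewrite (_ : (fun h => _) = fun h => upd y l h p.1 p.2 * \prod_(p <- ws') upd y l h p.1 p.2).
  have [d' hd'] : exists e : C, is_pder (fun h => upd y l h p.1 p.2) e.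
    rewrite /upd; case: (_ && _); last by exists 0; apply: is_pder_cst.
    exists (0 + 1); apply: is_pderD; first exact: is_pder_cst.
    by exists 'X => [z|]; rewrite ?hornerX // derivX hornerC.
  by eexists; apply: is_pderM hd' hd.
by apply/funext => h'; rewrite big_cons.
Qed.

End Spanning.

(** * The wedge of a subspace *)

Lemma big_iota0 (V : nmodType) m (F : nat -> V) :
  \sum_(q <- iota 0 m) F q = \sum_(q < m) F q.
Proof. by rewrite -(big_mkord xpredT F) /index_iota subn0. Qed.

Section KetW.
Variables (R : realType) (n : nat).
Local Notation C := (R[i]).
Implicit Types (f g : Fock R) (d : maya) (P : int) (u : Hvec R n).
Hypothesis n0 : (0 < n)%N.

Lemma FinC_wedge c P f : FinC n c f -> FinC n (c + 1) (wedge P f).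
Proof. by have [a [k ->]] := posP P n0; apply: FinC_psip. Qed.

Lemma FinC_contr c P f : FinC n c f -> FinC n (c - 1) (contr P f).
Proof. by have [a [k ->]] := posP P n0; apply: FinC_psim. Qed.

Lemma FinC_support (L : seq int) c f :
  (forall d, f d != 0 -> d.1 = c /\ forall P, P \notin L -> inm d P = (P <= 0)) ->
  FinC n c f.
Proof.
elim: L c f => [|P L IH] c f hf.
  have dv d : f d != 0 -> d = (0, part0).
    by move=> /hf[_ h]; apply: maya_ext => P; rewrite inm_vac h.
  have [z|nz] := eqVneq (f (0, part0)) 0.
    rewrite (_ : f = 0); first exact: FinC_zero.
    by apply/funext => d; apply/eqP; apply: contraT => /[dup] /dv ->; rewrite z eqxx.
  have -> : c = 0 by have [<- _] := hf _ nz.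
  rewrite (_ : f = f (0, part0) *: vac R); first exact/FinCZ/FinC_vac.
  apply/funext => d; rewrite -[RHS]/(f (0, part0) * vac R d) vacE.
  case: (d =P _) => [->|ne]; first by rewrite mulr1.
  by rewrite mulr0; apply/eqP; apply: contraT => /dv /ne.
have inL d Q : f d != 0 -> Q \notin L -> Q != P -> inm d Q = (Q <= 0).
  by move=> /hf[_ h] QL QP; apply: h; rewrite in_cons negb_or QP.
have e := wedge_contr P P f; rewrite eqxx scale1r in e.
have out d Q : f (mins d P) != 0 -> ~~ inm d P -> Q \notin L -> Q != P -> inm d Q = (Q <= 0).
  by move=> nz nP QL QP; rewrite -(inL _ _ nz QL QP) inm_mins // (negbTE QP) orbF.
have out' d Q : f (mdel d P) != 0 -> inm d P -> Q \notin L -> Q != P -> inm d Q = (Q <= 0).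
  by move=> nz nP QL QP; rewrite -(inL _ _ nz QL QP) inm_mdel // QP andbT.
have contr_nz g d : contr P g d != 0 -> ~~ inm d P /\ g (mins d P) != 0.
  rewrite contrE; case: ifPn; rewrite ?eqxx // => nP h; split=> //.
  by apply: contraNneq h => ->; rewrite mulr0.
have wedge_nz g d : wedge P g d != 0 -> inm d P /\ g (mdel d P) != 0.
  rewrite wedgeE; case: ifPn; rewrite ?eqxx // => nP h; split=> //.
  by apply: contraNneq h => ->; rewrite mulr0.
have [P0|P0] := ltrP 0 P.
  have f1 : FinC n (c - 1) (contr P f).
    apply: IH => d /contr_nz[nP nz]; split=> [|Q QL].
      by have [<- _] := hf _ nz; rewrite charge_mins addrK.
    have [->|QP] := eqVneq Q P; first by rewrite (negbTE nP) leNgt P0.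
    exact: out nz nP QL QP.
  have f2 : FinC n c (contr P (wedge P f)).
    apply: IH => d /contr_nz[nP /wedge_nz[_]]; rewrite minsK // => nz; split=> [|Q QL].
      by have [<- _] := hf _ nz.
    have [->|QP] := eqVneq Q P; first by rewrite (negbTE nP) leNgt P0.
    exact: inL nz QL QP.
  have -> : f = wedge P (contr P f) + contr P (wedge P f) by rewrite e subrK.
  by apply: FinCD => //; rewrite -[c](subrK 1); apply: FinC_wedge.
have f1 : FinC n (c + 1) (wedge P f).
  apply: IH => d /wedge_nz[nP nz]; split=> [|Q QL].
    by have [<- _] := hf _ nz; rewrite charge_mdel subrK.
  have [->|QP] := eqVneq Q P; first by rewrite nP P0.
  exact: out' nz nP QL QP.
have f2 : FinC n c (wedge P (contr P f)).
  apply: IH => d /wedge_nz[nP /contr_nz[_]]; rewrite mdelK // => nz; split=> [|Q QL].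
    by have [<- _] := hf _ nz.
  have [->|QP] := eqVneq Q P; first by rewrite nP P0.
  exact: inL nz QL QP.
have -> : f = wedge P (contr P f) + contr P (wedge P f) by rewrite e subrK.
by apply: FinCD => //; rewrite -[c](addrK 1); apply: FinC_contr.
Qed.

Lemma vcoord_pos u a k : vcoord u (pos a k) = u a k.
Proof.
rewrite /vcoord (bigD1 a) //= colz_pos eqxx tpow_pos big1 ?addr0 // => b ne.
by rewrite eqz_nat (_ : (b == a :> nat) = false) //; apply/negbTE.
Qed.

Lemma HjP j u : Hj j u <-> forall a k, j < pos a k -> u a k = 0.
Proof.
split=> [h a k /h|h P]; first by rewrite vcoord_pos.
by have [a [k ->]] := posP P n0 => /h; rewrite vcoord_pos.
Qed.

Lemma size_leE d m : (size (val d.2) <= m)%N = (sq d m == d.1 - m%:Z).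
Proof.
apply/idP/eqP => [/sq_large //|e]; rewrite leqNgt; apply/negP => lt.
have /andP[_ /allP pos] := valP d.2.
have : (0 < nth 0%N (val d.2) m)%N := pos _ (mem_nth 0%N lt).
by move: e; rewrite /sq; lia.
Qed.

Lemma above_sq d l : above d (sq d l) = l.
Proof.
rewrite /above; under eq_bigr => m _ do rewrite sq_ltE.
have lb : (l <= mbound d (sq d l))%N.
  by have := @sq_le_sub d 0 l; rewrite leNgt sq_ltE /mbound; lia.
rewrite (eq_bigr (fun m : 'I__ => if (m < l)%N then 1%N else 0%N)); last by move=> m _; case: ltnP.
by rewrite -big_mkcond -(big_ord_widen _ (fun=> 1%N) lb) sum1_card card_ord.
Qed.

Variables (N : nat) (w : 'I_N -> Hvec R n).

Lemma vcoord_sub u (c : 'I_N -> C) P :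
  vcoord (fun a k => u a k - lin_comb c w a k) P = vcoord u P - \sum_i c i * vcoord (w i) P.
Proof.
have [a [k ->]] := posP P n0; rewrite !vcoord_pos; congr (_ - _).
by apply: eq_bigr => i _; rewrite vcoord_pos.
Qed.

Lemma ketWE d : ketW w d = if (d.1 == 0) && (sq d N == - N%:Z)
           then \det (\matrix_(i < N, l < N) vcoord (w i) (sq d l)) else 0.
Proof.
by rewrite /ketW size_leE; case: (d.1 =P 0) => //= ->; rewrite sub0r.
Qed.

Lemma FinC_ketW (K : nat) : (forall i, lbound K (w i)) -> FinC n 0 (ketW w).
Proof.
move=> hK; apply: (@FinC_support (irange (N + n * K).+1)) => d.
rewrite /ketW; case: ifP; rewrite ?eqxx // => /andP[/eqP d0 sN] nz; split=> // P.
rewrite mem_irange negb_and -ltNge -leNgt => hP.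
apply/idP/idP => [inP|P0]; last by apply: inm_low; lia.
rewrite leNgt; apply: contra nz => P0; move: inP => /inmP[l e].
have lN : (l < N)%N.
  rewrite ltnNge; apply: contraTN P0 => Nl; rewrite -leNgt -e sq_large; lia.
(* A position this high lies beyond the pole bound K, so its column of coordinates is zero. *)
rewrite (expand_det_col _ (Ordinal lN)) big1 // => i _; rewrite !mxE /= e.
have [a [k eP]] := posP P n0; rewrite eP vcoord_pos (hK i a k) ?mul0r //.
by move: hP P0; rewrite eP /pos; have := ltn_ord a; nia.
Qed.

Variable W : Hvec R n -> Prop.
Hypothesis w_basis : basis_mod W (- N%:Z) w.

Lemma wedge_ketW_vanish u (K Q : nat) : W u -> lbound K u -> bnd n Q (ketW w) ->
  \sum_(a < n) \sum_(q < K + Q) u a (q%:Z - K%:Z) *: psip a (q%:Z - K%:Z) (ketW w) = 0.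
Proof.
move=> Wu hu hQ; apply/funext => d.
pose F P : C := vcoord u P * wedge P (ketW w) d.
transitivity (\sum_(P <- [seq pos a (q%:Z - K%:Z) | a <- enum 'I_n, q <- iota 0 (K + Q)]) F P).
  rewrite big_allpairs_dep /= big_enum /= fct_sumE; apply: eq_bigr => a _.
  rewrite fct_sumE big_iota0; apply: eq_bigr => q _.
  by rewrite /F vcoord_pos.
transitivity (\sum_(P <- [seq sq d l | l <- iota 0 N.+1]) F P).
  apply: sum_support.
  - apply: allpairs_uniq; rewrite ?enum_uniq ?iota_uniq // => -[a q] [b q'] _ _ /=.
    by move=> /pos_inj[-> e]; congr pair; lia.
  - by rewrite map_inj_uniq ?iota_uniq //; exact: sq_inj.
  move=> P FP; apply/idP/idP => _.
    have : inm d P by apply: contraNT FP => nP; rewrite /F wedgeE (negbTE nP) mulr0.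
    move=> /inmP[l e]; apply/mapP; exists l; rewrite // mem_iota leq0n add0n andTb.
    rewrite ltnNge; apply: contraNN FP => Nl; rewrite /F -e wedgeE inm_sq ketWE.
    rewrite charge_mdel sq_mdel Nl; case: (d.1 - 1 =P 0) => d1; last by rewrite /= !mulr0.
    have -> : (sq d N == - N%:Z) = false by rewrite /sq; lia.
    by rewrite /= !mulr0.
  have [a [k eP]] := posP P n0.
  have k1 : - K%:Z <= k.
    by rewrite leNgt; apply: contra FP => lt; rewrite /F eP vcoord_pos (hu a k lt) mul0r.
  have k2 : k < Q%:Z.
    rewrite ltNge; apply: contra FP => le; rewrite /F eP -/(psip a k _).
    by have [-> //] := hQ a k; rewrite mulr0.
  apply/allpairsP; exists (a, absz (k + K%:Z)); rewrite mem_enum mem_iota /=; split=> //; first lia.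
  by rewrite eP; congr pos; lia.
rewrite big_map big_iota0.
have [d1|d1] := eqVneq (d.1 - 1) 0; last first.
  apply: big1 => l _; rewrite /F wedgeE inm_sq ketWE charge_mdel (negbTE d1) /= !mulr0.
  by [].
have [sN|sN] := eqVneq (sq d N.+1) (- N%:Z); last first.
  apply: big1 => l _; rewrite /F wedgeE inm_sq ketWE sq_mdel ltnNge -ltnS ltn_ord /=.
  by rewrite (negbTE sN) andbF !mulr0.
have [_ _ span] := w_basis; have [c hc] := span u Wu.
have sqN (l : 'I_N.+1) : - N%:Z < sq d l.
  by rewrite /sq; have := ltn_ord l; lia.
(* The coefficient at d is the expansion along the first row of the determinant with u placed above
   the w_i; [above_sq] matches the wedge sign with the cofactor sign. *)
pose B : 'M[C]_(N.+1) := \matrix_(i, l) if unlift 0 i is Some i' then vcoord (w i') (sq d l)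
   else vcoord u (sq d l).
transitivity (\det B).
  rewrite (expand_det_row B 0); apply: eq_bigr => l _.
  rewrite /F wedgeE inm_sq ketWE sq_mdel ltnNge -ltnS ltn_ord charge_mdel d1 sN !eqxx /=.
  rewrite /sg above_sq !mxE unlift_none; congr (_ * _).
  rewrite /cofactor add0n; congr (_ * \det _).
  apply/matrixP => i m; rewrite !mxE liftK; congr (vcoord _ _).
  rewrite sq_mdel /= /bump; case: ltnP => h; congr (sq d _); lia.
(* The relation u = sum c_i w_i modulo H^(-N) is exact in these columns, because all N + 1 positions
   lie above -N. *)
apply/eqP/det0P; exists (\row_i if unlift 0 i is Some i' then - c i' else 1).
  by apply/negP => /eqP/rowP/(_ 0); rewrite !mxE unlift_none => /eqP; rewrite oner_eq0.
apply/rowP => l; rewrite !mxE big_ord_recl !mxE !unlift_none mul1r.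
have h := hc _ (sqN l); rewrite vcoord_sub in h; rewrite -[RHS]h; congr (_ + _).
by rewrite -sumrN; apply: eq_bigr => i _; rewrite !mxE !liftK mulNr.
Qed.

End KetW.

(** * Laurent vectors as sequences *)

Section Shift.
Variable F : comNzRingType.
Implicit Types a b c : nat -> F.

Definition shift a (q : nat) : F := if q is q'.+1 then a q' else 0.

Lemma shift_pred a q : (0 < q)%N -> shift a q = a q.-1.
Proof. by case: q. Qed.

Lemma conv_shift c a : conv c (shift a) = shift (conv c a).
Proof.
apply/funext => -[|q]; first by rewrite /conv big_ord1 subnn mulr0.
rewrite {1}/conv big_ord_recr /= (_ : shift a (q.+1 - q.+1)%N = 0); last by rewrite subnn.
rewrite mulr0 addr0; apply: eq_bigr => r _.
by have := ltn_ord r => rq; rewrite (_ : (q.+1 - r)%N = (q - r).+1) //; lia.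
Qed.

Definition alt a (q : nat) : F := (-1) ^+ q * a q.

Lemma alt_conv a b : alt (conv a b) = conv (alt a) (alt b).
Proof.
apply/funext => q; rewrite /alt mulr_sumr; apply: eq_bigr => r _.
have rq : (r + (q - r) = q)%N by have := ltn_ord r; lia.
by rewrite -{1}rq exprD; ring.
Qed.

Lemma conv_cancel a b c c' : conv c c' = @conv1 F -> conv (conv c a) (conv c' b) = conv a b.
Proof. by move=> e; rewrite [conv c a]convC -convA [conv c (conv c' b)]convA e conv1l. Qed.

(** Multiplication by a power series is moved from the vector to the functional; since e vanishes
    from M on, truncation loses nothing. *)
Lemma sum_conv (g V e : nat -> F) (M : nat) : (forall q, (M <= q)%N -> e q = 0) ->
  \sum_(q < M) conv g V q * e q = \sum_(q < M) V q * \sum_(r < M) g r * e (q + r)%N.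
Proof.
move=> he.
transitivity (\sum_(r < M) \sum_(q < M | (r <= q)%N) g r * V (q - r)%N * e q).
  rewrite (exchange_big_dep xpredT) //=; apply: eq_bigr => q _.
  rewrite mulr_suml (big_ord_widen M (fun r => g r * V (q - r)%N * e q)) //.
transitivity (\sum_(r < M) \sum_(q < M) V q * (g r * e (q + r)%N)); last first.
  by rewrite exchange_big; apply: eq_bigr => q _; rewrite mulr_sumr.
apply: eq_bigr => r _; have rM := ltn_ord r.
rewrite -(big_mkord (fun q => (r <= q)%N) (fun q => g r * V (q - r)%N * e q)).
rewrite -(big_mkord xpredT (fun q => V q * (g r * e (q + r)%N))).
rewrite (@big_cat_nat _ _ _ r) //=; last by lia.
rewrite big_nat_cond big1 ?add0r; last by move=> q; lia.
rewrite -{1}[r : nat]add0n big_addn.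
rewrite [RHS](@big_cat_nat _ _ _ (M - r)) //=; last by lia.
rewrite [X in _ = _ + X]big_nat_cond [X in _ = _ + X]big1 ?addr0; last first.
  by move=> q hq; rewrite he ?mulr0 //; lia.
by apply: eq_big => [q|q _]; [lia | rewrite addnK; ring].
Qed.

End Shift.

Section Laurent.
Variables (R : realType) (n : nat).
Local Notation C := (R[i]).
Implicit Types (u v : Hvec R n) (l : 'I_n) (c : 'I_n -> nat -> C).
Variable K : nat.

(* [sh u l] is the power series [t^K u_l], and [eX c u] multiplies each component [u_l] by the power
   series [c l]; both lose information unless [lbound K u]. *)
Definition sh u l (q : nat) : C := u l (q%:Z - K%:Z).

Lemma sh_ext u v : lbound K u -> lbound K v -> (forall l, sh u l = sh v l) -> u = v.
Proof.
move=> hu hv e; apply/funext => l; apply/funext => k.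
have [lt|le] := ltrP k (- K%:Z); first by rewrite hu ?hv.
have := congr1 (@^~ (absz (k + K%:Z))) (e l); rewrite /sh.
by rewrite (_ : _ - _ = k) //; lia.
Qed.

Definition eX c u : Hvec R n := fun l k =>
  if 0 <= k + K%:Z then conv (c l) (sh u l) (absz (k + K%:Z)) else 0.

Lemma sh_eX c u l : sh (eX c u) l = conv (c l) (sh u l).
Proof. by apply/funext => q; rewrite /sh /eX subrK. Qed.

Lemma lbound_eX c u : lbound K (eX c u).
Proof. by move=> l k lt; rewrite /eX ifF //; lia. Qed.

Lemma eX_lin c (x : C) u v :
  eX c (fun a k => x * u a k + v a k) = fun a k => x * eX c u a k + eX c v a k.
Proof.
apply/funext => l; apply/funext => k; rewrite /eX.
case: ifP => _; last by rewrite mulr0 addr0.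
by rewrite -convZr -convDr.
Qed.

Lemma eXK c c' u : (forall l, conv (c l) (c' l) = @conv1 C) -> lbound K u ->
  eX c (eX c' u) = u.
Proof.
move=> cc hu; apply: sh_ext => //; first exact: lbound_eX.
by move=> l; rewrite !sh_eX convA cc conv1l.
Qed.

Lemma eX_Hj c (j : int) u : (0 < n)%N -> Hj j u -> Hj j (eX c u).
Proof.
move=> n0 /(HjP n0) hu; apply/(HjP n0) => l k lt; rewrite /eX; case: ifP => // hk.
apply: big1 => r _; rewrite /sh hu ?mulr0 //; apply: lt_le_trans lt _.
have := ltn_ord r; rewrite /pos; nia.
Qed.

Lemma sh_tmul u l : lbound K u -> sh (tmul u) l = shift (sh u l).
Proof.
move=> hu; apply/funext => -[|q]; rewrite /sh /tmul /=; first by apply: hu; lia.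
by congr (u l _); lia.
Qed.

(** The residue is the coefficient of t^-1, and the two shifts by t^K move it to t^(2K-1).
    Substituting -t in u instead of v costs a global sign. *)
Lemma pairing_sh u v : (0 < K)%N ->
  pairing K u v = 'i * (-1) ^ (K%:Z - 1) * \sum_(a < n) conv (alt (sh u a)) (sh v a) (2 * K).-1.
Proof.
move=> K0; rewrite /pairing -mulrA; congr (_ * _); rewrite mulr_sumr; apply: eq_bigr => a _.
rewrite mulr_sumr /conv prednK; last by lia.
apply: eq_bigr => l _; have := ltn_ord l => lK; rewrite /alt /sh.
rewrite (_ : -1 - (l%:Z - K%:Z) = ((2 * K).-1 - l)%N%:Z - K%:Z); last by lia.
rewrite (_ : ((2 * K).-1 - l)%N%:Z - K%:Z = (K%:Z - 1) - l%:Z); last by lia.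
rewrite expfzDr ?oppr_eq0 ?oner_eq0 // -invr_expz -exprnP.
rewrite (_ : K%:Z - 1 - l%:Z = ((2 * K).-1 - l)%N%:Z - K%:Z); last by lia.
by rewrite -exprVn invrN invr1; ring.
Qed.

End Laurent.

(** * Wave functions *)

Lemma bnd_uniform (R : realType) (n : nat) (T : finType) (F : T -> Fock R) :
  (forall x, exists K, bnd n K (F x)) -> exists K, forall x, bnd n K (F x).
Proof.
move=> /boolp.choice[k hk]; exists (\max_x k x) => x.
exact: bnd_le (leq_bigmax x) (hk x).
Qed.

Section Main.
Variables (R : realType) (n : nat).
Local Notation C := (R[i]).
Hypothesis n0 : (0 < n)%N.
Variable W : Hvec R n -> Prop.
Hypothesis W_sub : subspace W.
Hypothesis W_H : forall u, W u -> laurent u.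
Variables (N : nat) (w : 'I_N -> Hvec R n).
Hypothesis HN : forall u, Hj (- N%:Z) u -> W u.
Hypothesis w_basis : basis_mod W (- N%:Z) w.
Variables (Q Qi : 'I_n -> Fock R -> Fock R).
Hypothesis HQ : Q_spec Q Qi.
Variable sigma : Fock R -> Target R n.
Hypothesis Hsigma : bf_spec Q Qi sigma.
Hypothesis W_t : forall u, W u -> W (tmul u).

Implicit Types (u v : Hvec R n) (i j k l : 'I_n) (y : Xvar R n).
Local Notation f := (ketW w).
Local Notation E := (tauF sigma (M0 n)).

Lemma W_lin_comb (c : 'I_N -> C) : W (lin_comb c w).
Proof.
have [W0 Wl] := W_sub; have [Ww _ _] := w_basis; rewrite /lin_comb.
elim: (index_enum _) => [|i r IH].
  rewrite (_ : (fun a m => \sum_(i <- [::]) c i * w i a m) = fun _ _ => 0) //.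
  by apply/funext => a; apply/funext => m; rewrite big_nil.
rewrite (_ : (fun a m => \sum_(i <- i :: r) c i * w i a m) = fun a m => c i * w i a m + \sum_(i <- r) c i * w i a m); first exact: Wl.
by apply/funext => a; apply/funext => m; rewrite big_cons.
Qed.

Lemma W_subr u v : W u -> W v -> W (fun a m => u a m - v a m).
Proof.
move=> Wu Wv; have [_ Wl] := W_sub.
rewrite (_ : (fun a m => u a m - v a m) = fun a m => -1 * v a m + u a m); first exact: Wl.
by apply/funext => a; apply/funext => m; rewrite mulN1r addrC.
Qed.

(** W is spanned by finitely many Laurent vectors modulo H^(-N), whose elements have no poles, so
    one pole bound serves all of W. *)
Lemma W_lbound : exists2 K, (0 < K)%N & forall u, W u -> lbound K u.
Proof.
have [Ww _ span] := w_basis.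
have [k hk] := boolp.choice (fun i : 'I_N => W_H (Ww i)).
exists (\max_i k i).+1 => // u Wu a m lt.
have [c /(HjP n0) hc] := span u Wu.
have := hc a m; rewrite [lin_comb _ _ _ _]big1 ?subr0 => [-> //|i _].
  by rewrite /pos; nia.
by rewrite hk ?mulr0 //; have := leq_bigmax i (F := k); lia.
Qed.

Lemma FinC_f : FinC n 0 f.
Proof.
have [Ww _ _] := w_basis; have [K _ hK] := W_lbound.
by apply: (FinC_ketW n0 (K := K)) => i; apply: hK.
Qed.

(** K bounds the poles in W, and B bounds the modes not killing |W> and the Q_l Q_i^-1 |W>. The gap
    K + B < M leaves room for the powers down to t^(-K), at every time y simultaneously. *)
Definition cutoff K M := [/\ (0 < K)%N, forall u, W u -> lbound K u &
  exists2 B, (K + B < M)%N & bnd n B f /\ forall i l, bnd n B (Q l (Qi i f))].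

Lemma cutoff_ex : exists K M, cutoff K M.
Proof.
have [K K0 hK] := W_lbound.
have [B1 h1] := FinC_bnd FinC_f.
have [B2 h2] : exists B, forall p : 'I_n * 'I_n, bnd n B (Q p.2 (Qi p.1 f)).
  by apply: bnd_uniform => p; apply: FinC_bnd (FinC_QQi n0 HQ p.1 p.2 FinC_f).
exists K, (K + maxn B1 B2).+1; split=> //; exists (maxn B1 B2) => //; split.
  by apply: bnd_le h1; apply: leq_maxl.
by move=> i l; apply: bnd_le (h2 (i, l)); apply: leq_maxr.
Qed.

Variables (K M : nat).
Hypothesis cut : cutoff K M.

Let K0 : (0 < K)%N. Proof. by have [] := cut. Qed.
Let KM : (K < M)%N. Proof. by have [_ _ [B lt _]] := cut; lia. Qed.
Let hWK u : W u -> lbound K u. Proof. by have [_ h _] := cut; apply: h. Qed.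

Local Notation hs y := (fun l => hseq (y l)).
Local Notation gs y := (fun l => hseq (fun m => - y l m)).
Local Notation V y u l := (conv (hseq (y l)) (sh K u l)).
(** The index q stands for the power t^(q-K): [K.-1] is the t^-1 coefficient and [K] the constant
    one. *)
Local Notation G y i l q := (Gf Qi sigma i y f M l (q%:Z - K%:Z)).

Lemma G_low y i l (q : nat) : (q.+1 < K)%N -> G y i l q = 0.
Proof.
move=> qK; have [_ _ [B lt [hB hB']]] := cut.
have [->|ne] := eqVneq l i.
  rewrite (_ : q%:Z - K%:Z = - 1 - (K - q.+1)%N%:Z); last by lia.
  rewrite (Gf_same n0 HQ Hsigma _ _ FinC_f hB); last by lia.
  by rewrite (_ : (K - q.+1 == 0)%N = false) ?mul0r //; lia.
rewrite (_ : q%:Z - K%:Z = - (K - q)%N%:Z); last by lia.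
rewrite (Gf_diff n0 HQ Hsigma _ ne FinC_f (hB' i l)); last by lia.
by rewrite (_ : (K - q == 0)%N = false) ?mul0r ?oppr0 //; lia.
Qed.

Lemma G_pred y i l : G y i l K.-1 = (l == i)%:R * E y f.
Proof.
have [_ _ [B lt [hB hB']]] := cut.
have [->|ne] := eqVneq l i.
  rewrite (_ : K.-1%:Z - K%:Z = - 1 - 0%N%:Z); last by have := K0; lia.
  by rewrite (Gf_same n0 HQ Hsigma _ _ FinC_f hB) //; lia.
rewrite (_ : K.-1%:Z - K%:Z = - 1%N%:Z); last by have := K0; lia.
by rewrite (Gf_diff n0 HQ Hsigma _ ne FinC_f (hB' i l)) ?mul0r ?oppr0 //; have := K0; lia.
Qed.

Lemma G_K y i l : l != i -> G y i l K = - E y (Q l (Qi i f)).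
Proof.
move=> ne; have [_ _ [B lt [hB hB']]] := cut.
rewrite subrr (_ : 0 = - 0%N%:Z) //.
by rewrite (Gf_diff n0 HQ Hsigma _ ne FinC_f (hB' i l)) ?eqxx ?mul1r //; lia.
Qed.

(** Apply E_y Q_i^-1 to psi(u) |W> = 0, write u = e^(-X) e^X u, and move e^(-X) onto the fermion
    with [sum_conv]. *)
Lemma relation y i u : W u -> \sum_(l < n) \sum_(q < M) V y u l q * G y i l q = 0.
Proof.
move=> Wu; have [_ _ [B lt [hB _]]] := cut.
have := wedge_ketW_vanish n0 w_basis (Q := (M - K)%N) Wu (hWK Wu).
have le : (B <= M - K)%N by lia.
move=> /(_ (bnd_le le hB)); rewrite subnKC; last by lia.
move=> /(congr1 (fun g => E y (Qi i g))).
rewrite pair_big /= (E_Qi_sum HQ Hsigma).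
have -> : E y (Qi i 0) = 0.
  by have := E_Qi_sum HQ Hsigma y i [::] (fun _ : nat => 0) (fun=> 0); rewrite !big_nil.
move=> e; rewrite -[RHS]e -(pair_big xpredT xpredT (fun l (q : 'I_M) => sh K u l q * E y (Qi i (psip l (q%:Z - K%:Z) f)))) /=.
apply: eq_bigr => l _.
have e' : sh K u l = conv (gs y l) (V y u l) by rewrite convA hseq_inv conv1l.
rewrite [in RHS]e' (@sum_conv _ _ _ (fun q : nat => E y (Qi i (psip l (q%:Z - K%:Z) f)))).
  apply: eq_bigr => q _; congr (_ * _); apply: eq_bigr => r _; congr (_ * E y (Qi i (psip _ _ _))); lia.
move=> q Mq; have [h _] := hB l (q%:Z - K%:Z).
rewrite h; last by lia.
by have := E_Qi_sum HQ Hsigma y i [::] (fun _ : nat => 0) (fun=> 0); rewrite !big_nil.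
Qed.

Lemma sum_V y u (D : 'I_n -> nat -> C) :
  (forall l q, (K <= q)%N -> V y u l q = 0) -> (forall l q, (q.+1 < K)%N -> D l q = 0) ->
  \sum_(l < n) \sum_(q < M) V y u l q * D l q = \sum_(l < n) V y u l K.-1 * D l K.-1.
Proof.
move=> hV hD; apply: eq_bigr => l _; have p1 : (K.-1 < M)%N by lia.
rewrite (bigD1 (Ordinal p1)) //= big1 ?addr0 // => q ne.
have {}ne : nat_of_ord q != K.-1 by [].
have [le|lt] := leqP K q; first by rewrite hV // mul0r.
by rewrite hD ?mulr0 //; have := K0; lia.
Qed.

Lemma V_tmul y u l : W u -> V y (tmul u) l = shift (V y u l).
Proof. by move=> Wu; rewrite sh_tmul ?conv_shift //; apply: hWK. Qed.

(** * Trivial kernel of the projection, and existence of the wave vectors *)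

Section Nonvanishing.
Variable y : Xvar R n.
Hypothesis E0 : E y f != 0.

Lemma V_kernel u : W u -> (forall l q, (K <= q)%N -> V y u l q = 0) ->
  forall l q, V y u l q = 0.
Proof.
move=> Wu hV.
suff key p : forall l q, (K - p <= q)%N -> V y u l q = 0.
  by move=> l q; apply: (key K); rewrite subnn.
elim: p => [|p IH] i q; first by rewrite subn0; apply: hV.
have [lt|le] := ltnP p K; last by move=> _; apply: IH; lia.
have [e _|ne] := eqVneq q (K - p.+1)%N; last by move=> h; apply: IH; lia.
(* Multiplying u by t^p brings the first coefficient not yet known to vanish to index K - 1, where
   the relation reads it off times tau_0. *)
have shiftV : exists2 v, W v & forall l q, V y v l q = if (q < p)%N then 0 else V y u l (q - p)%N.
  elim: (p) => [|p' [v Wv hv]]; first by exists u => // l r; rewrite subn0.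
  exists (tmul v) => [|l [|r]]; rewrite ?V_tmul //; first exact: W_t.
  by rewrite /= hv.
have [v Wv hv] := shiftV.
have := relation y i Wv; rewrite (@sum_V y v (fun l (q : nat) => G y i l q)); last first.
- by move=> l r; apply: G_low.
- by move=> l r Kr; rewrite hv; case: ltnP => // pr; apply: IH; lia.
rewrite (bigD1 i) //= G_pred eqxx mul1r big1 ?addr0 => [|l /negbTE ne]; last first.
  by rewrite G_pred ne mul0r mulr0.
move/eqP; rewrite mulf_eq0 (negbTE E0) orbF hv ifF; last by lia.
by move=> /eqP; rewrite e (_ : (K.-1 - p = K - p.+1)%N) //; lia.
Qed.

Lemma eX_kernel u : W u -> (forall l q, (K <= q)%N -> V y u l q = 0) -> eX K (hs y) u = fun _ _ => 0.
Proof.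
move=> Wu hV; apply: (sh_ext (K := K)) => //; first exact: lbound_eX.
by move=> l; rewrite sh_eX; apply/funext => q; rewrite V_kernel.
Qed.

Lemma gs_hs l : conv (gs y l) (hs y l) = @conv1 C.
Proof. exact: hseq_inv. Qed.

Lemma hs_gs l : conv (hs y l) (gs y l) = @conv1 C.
Proof. by rewrite convC gs_hs. Qed.

(* The part of [v] in [H^(-N)] can be subtracted inside [W], because [e^(-X)] preserves [H^(-N)]. *)
Lemma correct_low v : lbound K v -> exists z, [/\ W z, Hj (- N%:Z) z,
  forall a m, - N%:Z < pos a m -> eX K (hs y) z a m = 0 &
  forall a m, pos a m <= - N%:Z -> eX K (hs y) z a m = v a m].
Proof.
move=> hv; pose v' : Hvec R n := fun a m => if pos a m <= - N%:Z then v a m else 0.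
have v'H : Hj (- N%:Z) v'.
  by apply/(HjP n0) => a m lt; rewrite /v' ifF //; lia.
have lv' : lbound K v' by move=> a m lt; rewrite /v' hv // if_same.
have zH := @eX_Hj _ _ K (gs y) _ _ n0 v'H.
have e := eXK hs_gs lv'.
exists (eX K (gs y) v'); split => //; first exact: HN.
  by move=> a m lt; rewrite e /v' ifF //; lia.
by move=> a m le; rewrite e /v' le.
Qed.

Lemma eX_sub u v : eX K (hs y) (fun a m => u a m - v a m) =
  fun a m => eX K (hs y) u a m - eX K (hs y) v a m.
Proof.
rewrite (_ : (fun a m => u a m - v a m) = fun a m => -1 * v a m + u a m); last first.
  by apply/funext => a; apply/funext => m; rewrite mulN1r addrC.
by rewrite eX_lin; apply/funext => a; apply/funext => m; rewrite mulN1r addrC.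
Qed.

Lemma V_nonneg u l q : (K <= q)%N -> V y u l q = eX K (hs y) u l (q - K)%N%:Z.
Proof. by move=> Kq; rewrite -[conv _ _](sh_eX K (hs y) u l) /sh; congr (eX _ _ _ _ _); lia. Qed.

Lemma eX_lin_comb (c : 'I_N -> C) P :
  vcoord (eX K (hs y) (lin_comb c w)) P = \sum_(i < N) c i * vcoord (eX K (hs y) (w i)) P.
Proof.
have [a [m ->]] := posP P n0; rewrite vcoord_pos; under eq_bigr do rewrite vcoord_pos.
rewrite /eX; case: ifP => _; last by rewrite big1 // => i _; rewrite mulr0.
under eq_bigr do rewrite -convZr.
rewrite /conv exchange_big; apply: eq_bigr => r _ /=.
by rewrite /sh /lin_comb mulr_sumr.
Qed.

(* The matrix of the projection [e^X W -> C^n[[t]]] modulo [H^(-N)]. *)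
Lemma proj_unit : (\matrix_(i < N, m < N) vcoord (eX K (hs y) (w i)) (- m%:Z)) \in unitmx.
Proof.
set A := (X in X \in _); rewrite -row_free_unit -kermx_eq0; apply/eqP/row_matrixP => r.
rewrite row0; set c := row r _; have cA : c *m A = 0 by apply/sub_kermxP/row_sub.
pose u := lin_comb (c 0) w; have Wu : W u by apply: W_lin_comb.
have [z [Wz zH z1 z2]] := correct_low (@lbound_eX _ _ K (hs y) u).
(* Above -N the kernel condition makes e^X u vanish; at and below -N it agrees with e^X z by the
   choice of z. *)
have uP a m : 0 <= m -> eX K (hs y) u a m = eX K (hs y) z a m.
  move=> m0; have [le|lt] := lerP (pos a m) (- N%:Z); first by rewrite z2.
  rewrite z1 // -vcoord_pos eX_lin_comb.
  have pm : pos a m <= 0 by rewrite pos_le0.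
  have lN : (absz (pos a m) < N)%N by lia.
  have h := congr1 (fun B : 'rV_N => B 0 (Ordinal lN)) cA; rewrite !mxE in h; rewrite -[RHS]h.
  by apply: eq_bigr => i _; rewrite !mxE /=; congr (_ * vcoord _ _); lia.
have ker : eX K (hs y) (fun a m => u a m - z a m) = fun _ _ => 0.
  apply: eX_kernel; first exact: W_subr.
  by move=> l q Kq; rewrite V_nonneg // eX_sub uP // subrr.
have e : u = z.
  have lu := hWK (W_subr Wu Wz); have := eXK gs_hs lu; rewrite ker => e.
  apply/funext => a; apply/funext => m; apply/eqP; rewrite -subr_eq0.
  rewrite -[u a m - z a m]/((fun a m => u a m - z a m) a m) -e /eX; apply/eqP.
  by case: ifP => // _; apply: big1 => q _; rewrite mulr0.
have [_ free _] := w_basis.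
by apply/rowP => i; rewrite [RHS]mxE; apply: free; rewrite -/u e.
Qed.

Lemma wave_exists j : exists2 u, W u & forall l q, (K <= q)%N -> V y u l q = ((l == j) && (q == K))%:R.
Proof.
set A := \matrix_(i < N, m < N) vcoord (eX K (hs y) (w i)) (- m%:Z).
pose ej : Hvec R n := fun l m => ((l == j) && (m == 0))%:R.
pose c := (\row_m vcoord ej (- m%:Z)) *m invmx A.
pose u := lin_comb (c 0) w; have Wu : W u by apply: W_lin_comb.
(* The matrix controls only the positions from -N + 1 to 0; the remaining discrepancy with e_j is
   removed by [correct_low]. *)
have lv : lbound K (fun a m => eX K (hs y) u a m - ej a m).
  move=> a m lt; rewrite lbound_eX // sub0r /ej (_ : (m == 0) = false) ?andbF ?oppr0 //; lia.
have [z [Wz zH z1 z2]] := correct_low lv.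
exists (fun a m => u a m - z a m); first exact: W_subr.
move=> l q Kq; rewrite V_nonneg // eX_sub.
set m := (q - K)%N%:Z; have m0 : 0 <= m by [].
transitivity (ej l m); last by rewrite /ej /m; congr (_ && _)%:R; lia.
have [le|lt] := lerP (pos l m) (- N%:Z); first by rewrite z2 // subKr.
rewrite z1 // subr0 -!vcoord_pos eX_lin_comb.
have pm : pos l m <= 0 by rewrite pos_le0.
have lN : (absz (pos l m) < N)%N by lia.
have cA : c *m A = \row_m vcoord ej (- m%:Z) by rewrite mulmxKV // proj_unit.
have := congr1 (fun B : 'rV_N => B 0 (Ordinal lN)) cA; rewrite !mxE /=.
rewrite (_ : - (absz (pos l m))%:Z = pos l m); last by lia.
move=> <-; apply: eq_bigr => i _; rewrite [A _ _]mxE /=; congr (_ * vcoord _ _); lia.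
Qed.

(** * Symmetry and derivatives of the coefficients B_ij *)

Section Wave.
Variable psi : 'I_n -> Hvec R n.
Hypothesis psiW : forall j, W (psi j).
Hypothesis psiV : forall j l q, (K <= q)%N -> V y (psi j) l q = ((l == j) && (q == K))%:R.

Definition Bcoef i j : C := V y (psi j) i K.-1.

Lemma sum_two (a b : nat -> C) M' : (K < M')%N ->
  (forall q, (K < q)%N -> a q = 0) -> (forall q, (q.+1 < K)%N -> b q = 0) ->
  \sum_(q < M') a q * b q = a K.-1 * b K.-1 + a K * b K.
Proof.
move=> KM' ha hb; have p1 : (K.-1 < M')%N by lia.
rewrite (bigD1 (Ordinal p1)) //= (bigD1 (Ordinal KM')) /=; last first.
  by apply/negP => /eqP/(congr1 val) /=; have := K0; lia.
rewrite big1 ?addr0 // => q /andP[ne1 ne2].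
have {}ne1 : nat_of_ord q != K.-1 by [].
have {}ne2 : nat_of_ord q != K by [].
have [lt|le] := ltnP K q; first by rewrite ha // mul0r.
by rewrite hb ?mulr0 //; have := K0; lia.
Qed.

Lemma psiV0 j l q : (K < q)%N -> V y (psi j) l q = 0.
Proof.
by move=> lt; rewrite psiV ?(ltnW lt) // (_ : (q == K) = false) ?andbF //; lia.
Qed.

Lemma psiVK j l : V y (psi j) l K = (l == j)%:R.
Proof. by rewrite psiV // eqxx andbT. Qed.

(** Stated for a general D because it serves both for G and for its derivatives in a time. *)
Lemma psi_sum i j (D : 'I_n -> nat -> C) (x : C) : i != j -> (forall l q, (q.+1 < K)%N -> D l q = 0) ->
  (forall l, D l K.-1 = (l == i)%:R * x) ->
  \sum_(l < n) \sum_(q < M) V y (psi j) l q * D l q = Bcoef i j * x + D j K.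
Proof.
move=> ne D0 D1.
rewrite (eq_bigr (fun l => V y (psi j) l K.-1 * D l K.-1 + (l == j)%:R * D l K)); last first.
  move=> l _; rewrite (@sum_two (V y (psi j) l) (D l)) ?psiVK //; last exact: D0.
  exact: psiV0.
rewrite big_split /=; congr (_ + _).
  rewrite (bigD1 i) //= D1 eqxx mul1r big1 ?addr0 // => l /negbTE nl.
  by rewrite D1 nl mul0r mulr0.
by rewrite (bigD1 j) //= eqxx mul1r big1 ?addr0 // => l /negbTE ->; rewrite mul0r.
Qed.

Lemma Bcoef_E i j : i != j -> E y (Q j (Qi i f)) = Bcoef i j * E y f.
Proof.
move=> ne; have := relation y i (psiW j).
rewrite (@psi_sum i j (fun l q => G y i l q) (E y f)) //; last exact: G_pred.
  by rewrite G_K 1?eq_sym // => /eqP; rewrite subr_eq0 => /eqP.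
by move=> l q; apply: G_low.
Qed.

Lemma Bcoef_sym i j : isotropic W -> (forall l q, ~~ odd q -> y l q = 0) -> Bcoef i j = Bcoef j i.
Proof.
move=> iso yodd; have := iso K _ _ (psiW i) (psiW j) (hWK (psiW i)) (hWK (psiW j)).
move=> /eqP; rewrite pairing_sh // mulf_eq0 mulf_eq0 expfz_eq0 oppr_eq0 oner_eq0 andbF orbF.
rewrite (negbTE (neq0Ci _)) /= => /eqP.
rewrite (eq_bigr (fun a => (-1) ^+ K.-1 * (V y (psi i) a K.-1 * (a == j)%:R
   - (a == i)%:R * V y (psi j) a K.-1))).
  rewrite -mulr_sumr => /eqP; rewrite mulf_eq0 signr_eq0 /= sumrB.
  rewrite (bigD1 j) //= eqxx mulr1 big1 ?addr0; last by move=> l /negbTE ->; rewrite mulr0.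
  rewrite (bigD1 i) //= eqxx mul1r big1 ?addr0; last by move=> l /negbTE ->; rewrite mul0r.
  by rewrite subr_eq0 => /eqP.
move=> a _.
have e l : sh K (psi l) a = conv (gs y a) (V y (psi l) a) by rewrite convA hseq_inv conv1l.
(* With odd times only, e^(-X(-t)) = e^(X(t)), so the two exponentials cancel in the pairing and e^X
   W is isotropic too. *)
have ag : alt (gs y a) = hs y a.
  by apply/funext => q; rewrite /alt (hseq_odd _ (yodd a)) mulrA -exprMn mulrNN mulr1 expr1n mul1r.
set rhs := (X in _ = X); rewrite e [in X in conv _ X]e alt_conv ag.
rewrite (conv_cancel _ _ (hs_gs a)).
rewrite /conv prednK; last by have := K0; lia.
(* The degree 2K - 1 splits only as (K - 1) + K and K + (K - 1); their opposite signs give the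
   difference of the B's. *)
rewrite (@sum_two (alt (V y (psi i) a)) (fun r => V y (psi j) a ((2 * K).-1 - r)%N)); first last.
- by move=> q hq; apply: psiV0; lia.
- by move=> q hq; rewrite /alt psiV0 ?mulr0.
- by have := K0; lia.
rewrite (_ : (2 * K).-1 - K.-1 = K)%N; last by have := K0; lia.
rewrite (_ : (2 * K).-1 - K = K.-1)%N; last by have := K0; lia.
have eK : (-1) ^+ K = - (-1) ^+ K.-1 :> C by rewrite -{1}(prednK K0) exprS mulN1r.
by rewrite /rhs psiVK /alt psiVK eK; ring.
Qed.

Lemma upd0 (z : Xvar R n) k : upd z k 0 = z.
Proof.
apply/funext => l; apply/funext => m; rewrite /upd.
by case: ifP => _ //; rewrite addr0.
Qed.

Lemma hseq_upd (z : Xvar R n) k l q :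
  is_pder (fun h => hseq (upd z k h l) q) ((l == k)%:R * shift (hseq (z l)) q).
Proof.
have [->|ne] := eqVneq l k.
  rewrite mul1r (_ : (fun h => _) = fun h => hseq (fun m => z k m + (m == 1)%:R * h) q).
    exact: is_pder_hseq.
  apply/funext => h; congr hseq; apply/funext => m; rewrite /upd eqxx /=.
  by case: eqP; rewrite ?mul1r // mul0r addr0.
rewrite mul0r (_ : (fun h => _) = fun=> hseq (z l) q); first exact: is_pder_cst.
by apply/funext => h; congr hseq; apply/funext => m; rewrite /upd (negbTE ne).
Qed.

(** For a fixed u, the derivative along x^(k)_1 multiplies component k of e^X u by t. *)
Lemma V_upd k u l q :
  is_pder (fun h => V (upd y k h) u l q) ((l == k)%:R * shift (V y u l) q).
Proof.
rewrite -[shift _ _]/(shift (conv _ _) q) [conv _ _]convC -conv_shift convC mulr_sumr.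
rewrite (eq_bigr (fun r : 'I_q.+1 => ((l == k)%:R * shift (hseq (y l)) r) * sh K u l (q - r)%N)); last first.
  by move=> r _; rewrite mulrA.
apply: is_pder_sum => r; have := is_pderM (hseq_upd y k l r) (is_pder_cst (sh K u l (q - r)%N)).
by rewrite mulr0 addr0.
Qed.

(** Existence is enough: in [deriv_relation] the values are needed only at indices where G is known
    explicitly. *)
Lemma G_upd k i l q : exists d, is_pder (fun h => G (upd y k h) i l q) d.
Proof.
have H (r : 'I_M) : exists d : C, is_pder (fun h =>
    hseq (fun m => - upd y k h l m) r * E (upd y k h) (Qi i (psip l (q%:Z - K%:Z + r%:Z) f))) d.
  have [d hd] := E_pder n0 HQ Hsigma y k (FinC_Qi_psip n0 HQ i l (q%:Z - K%:Z + r%:Z) FinC_f).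
  have hr := is_pder_opp (hseq_upd (fun l m => - y l m) k l r).
  rewrite (_ : (fun h => _) = fun h => hseq (fun m => - upd y k h l m) r) in hr.
    by eexists; apply: is_pderM hr hd.
  apply/funext => h; congr hseq; apply/funext => m; rewrite /upd.
  by case: ifP => // _; rewrite opprD.
by have [dr hdr] := boolp.choice H; exists (\sum_(r < M) dr r); apply: is_pder_sum.
Qed.

(** The vector psi_j is frozen at the time y, so it need not be differentiated. The left side is
    tau_0 times the derivative of the quotient E(Q_j Q_i^-1 |W>) / E(|W>). *)
Lemma deriv_relation k i j (d dE : C) : i != j ->
  is_pder (fun h => E (upd y k h) (Q j (Qi i f))) d ->
  is_pder (fun h => E (upd y k h) f) dE ->
  d - Bcoef i j * dE = \sum_(q < M) shift (V y (psi j) k) q * G y i k q.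
Proof.
move=> ne hd hdE.
have [dG hdG] := boolp.choice (fun p : 'I_n * nat => G_upd k i p.1 p.2).
have tot : is_pder (fun h => \sum_(l < n) \sum_(q < M) V (upd y k h) (psi j) l q * G (upd y k h) i l q)
   (\sum_(l < n) \sum_(q < M) ((l == k)%:R * shift (V y (psi j) l) q * G y i l q
      + V y (psi j) l q * dG (l, nat_of_ord q))).
  apply: is_pder_sum => l; apply: is_pder_sum => q.
  by have := is_pderM (V_upd k (psi j) l q) (hdG (l, nat_of_ord q)); rewrite upd0.
rewrite (_ : (fun h => _) = fun=> 0) in tot; last first.
  by apply/funext => h; apply: relation.
have := is_pder_uniq tot (is_pder_cst 0).
under eq_bigr => l _ do rewrite big_split /=.
rewrite big_split /= (bigD1 k) //= [X in _ + X + _]big1 ?addr0; last first.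
  by move=> l /negbTE nl; apply: big1 => q _; rewrite nl !mul0r.
under eq_bigr => q _ do rewrite eqxx mul1r.
rewrite (@psi_sum i j (fun l q => dG (l, q)) dE) //; first last.
- move=> l; apply: (is_pder_uniq (hdG (l, K.-1))).
  rewrite (_ : (fun h => _) = fun h => (l == i)%:R * E (upd y k h) f); first exact: is_pderZ.
  by apply/funext => h; apply: G_pred.
- move=> l q hq; apply: (is_pder_uniq (hdG (l, q))).
  rewrite (_ : (fun h => _) = fun=> 0); first exact: is_pder_cst.
  by apply/funext => h; apply: G_low.
have -> : dG (j, K) = - d.
  apply: (is_pder_uniq (hdG (j, K))).
  rewrite (_ : (fun h => _) = fun h => - E (upd y k h) (Q j (Qi i f))); first exact: is_pderN.
  by apply/funext => h; rewrite G_K // eq_sym.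
by move=> /eqP; rewrite addr_eq0 => /eqP ->; rewrite opprD opprK addrC.
Qed.

(** For k distinct from j, component k of t e^X psi_j starts at the constant term, with coefficient
    B_kj; for k distinct from i, only that term meets G, with value - B_ik tau_0. *)
Lemma shift_sum k i j : k != i -> k != j ->
  \sum_(q < M) shift (V y (psi j) k) q * G y i k q = - (Bcoef k j * Bcoef i k * E y f).
Proof.
move=> ki kj; rewrite (@sum_two (shift (V y (psi j) k)) (fun q => G y i k q)) //.
- rewrite G_pred (negbTE ki) mul0r mulr0 add0r G_K // Bcoef_E 1?eq_sym // mulrN mulrA.
  by rewrite shift_pred.
- case=> // q; rewrite ltnS leq_eqVlt => /orP[/eqP <-|lt] /=; first by rewrite psiVK (negbTE kj).
  exact: psiV0.
- by move=> q; apply: G_low.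
Qed.

Lemma shift_sum_total i j :
  \sum_(k < n) \sum_(q < M) shift (V y (psi j) k) q * G y i k q = 0.
Proof.
rewrite -[RHS](relation y i (W_t (psiW j))); apply: eq_bigr => k _.
by apply: eq_bigr => q _; rewrite V_tmul.
Qed.

End Wave.

End Nonvanishing.

End Main.

Lemma upd_restrict_even (R : realType) (n : nat) (x : Xvar R n) k h :
  restrict_even (upd x k h) = upd (restrict_even x) k h.
Proof.
apply/funext => l; apply/funext => m; rewrite /restrict_even /upd.
case: ifP => od //; case: ifP => // /andP[_ /eqP m1].
by rewrite m1 in od.
Qed.

Theorem theorem4 (R : realType) (n : nat) (hn : (2 <= n)%N)
  (W : Hvec R n -> Prop) (W_sub : subspace W)
  (W_H : forall u, W u -> laurent u) (W_gr2 : in_gr2 W)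
  (N : nat) (w : 'I_N -> Hvec R n)
  (HN : forall u, Hj (- N%:Z) u -> W u) (w_basis : basis_mod W (- N%:Z) w)
  (Q Qi : 'I_n -> Fock R -> Fock R) (HQ : Q_spec Q Qi)
  (sigma : Fock R -> Target R n) (Hsigma : bf_spec Q Qi sigma) :
  let tau (g0 : Mlat n) (x : Xvar R n) : R[i] := sigma (ketW w) g0 x in
  let gam (i j : 'I_n) (x : Xvar R n) : R[i] :=
    @epsM R n j i * tau (Msub (delta i) (delta j)) (restrict_even x)
             / tau (M0 n) (restrict_even x) in
  forall x : Xvar R n, tau (M0 n) (restrict_even x) != 0 ->
    [/\ forall i j : 'I_n, i != j -> gam i j x = gam j i x,
        forall i j k : 'I_n, i != j -> j != k -> i != k ->
          pd k (gam i j) x = gam i k x * gam k j x &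
        forall i j : 'I_n, i != j -> \sum_(k < n) pd k (gam i j) x = 0].
Proof.
move=> tau0 gam x E0; have n0 : (0 < n)%N by lia.
have [[_ W_t] iso] := W_gr2.
have [K [M cut]] := cutoff_ex n0 W_H w_basis HQ.
set y := restrict_even x in E0 *.
have wave j : exists u, W u /\ forall l q, (K <= q)%N ->
    conv (hseq (y l)) (sh K u l) q = ((l == j) && (q == K))%:R.
  have [u Wu hu] := wave_exists n0 W_sub W_H HN w_basis HQ Hsigma W_t cut E0 j.
  by exists u.
have [psi psiP] := boolp.choice wave.
have psiW j : W (psi j) by have [] := psiP j.
have psiV j l q := (psiP j).2 l q.
pose B i j := Bcoef K y psi i j.
have Ff := FinC_f n0 W_H w_basis.
pose E := tauF sigma (M0 n).
have gamE i j z : i != j -> gam i j z =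
    - E (restrict_even z) (Q j (Qi i (ketW w))) / E (restrict_even z) (ketW w).
  by move=> ne; rewrite /E -(tau_delta n0 HQ Hsigma _ ne Ff).
have gamB i j : i != j -> gam i j x = - B i j.
  move=> ne; rewrite gamE // -/y /E.
  by rewrite (Bcoef_E n0 W_H w_basis HQ Hsigma cut E0 psiW psiV ne) -mulNr mulfK.
have pdE k i j : i != j -> pd k (gam i j) x =
    - (\sum_(q < M) shift (conv (hseq (y k)) (sh K (psi j) k)) q *
        Gf Qi sigma i y (ketW w) M k (q%:Z - K%:Z)) / E y (ketW w).
  move=> ne.
  have [d hd] := E_pder n0 HQ Hsigma y k (FinC_QQi n0 HQ i j Ff).
  have [dE hdE] := E_pder n0 HQ Hsigma y k Ff.
  rewrite -(deriv_relation n0 W_H w_basis HQ Hsigma cut E0 psiW psiV ne hd hdE) -/(B i j).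
  (* By the quotient rule and [Bcoef_E] the derivative is -(d - B_ij dE) / tau_0, whose numerator is
     that of [deriv_relation]. *)
  rewrite /pd (rderiv0_frac (is_pderN hd) hdE) ?upd0 //; last first.
    by move=> h _; rewrite gamE // upd_restrict_even.
  rewrite (Bcoef_E n0 W_H w_basis HQ Hsigma cut E0 psiW psiV ne) -/(B i j).
  by rewrite -/E; move: (E y _) (E0 : E y (ketW w) != 0) => e e0; field.
split=> [i j ne|i j k ij jk ik|i j ne].
- rewrite !gamB // 1?eq_sym //; congr (- _).
  apply: (Bcoef_sym n0 cut E0 psiW psiV i j iso) => l q ev.
  by rewrite /y /restrict_even (negbTE ev).
- have [ki kj] : k != i /\ k != j by split; rewrite eq_sym.
  rewrite pdE // (shift_sum n0 W_H w_basis HQ Hsigma cut E0 psiW psiV ki kj) !gamB //.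
  by rewrite opprK mulfK // mulrNN mulrC.
(* [pdE] places no restriction on k, so k = i and k = j are covered and the whole sum is the
   relation for t psi_j. *)
- under eq_bigr => k _ do rewrite pdE //.
  by rewrite -mulr_suml sumrN (shift_sum_total n0 w_basis HQ Hsigma W_t cut y psiW i j) oppr0 mul0r.
Qed.
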